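(* (a) The following assertion is false: for every $T>0$, every complex Banach space $X$, every linear subspace $D\subset X$, every $\omega\in\mathbb{R}$ and every family $A(t):D\subset X\to X$, $t\in[0,T]$, such that each $A(t)$ (with domain $D$) is the generator of a strongly continuous group with $\|e^{A(t)s}\|\leq e^{\omega|s|}$ for all $s\in\mathbb{R}$ and such that $t\mapsto A(t)\in\mathscr{L}(Y,X)$ is continuous and of bounded variation, there exists a unique evolution system for $A(t)$ on $D$. (b) For every $\alpha\in(0,1)$ the following assertion is false: for every $T>0$, every complex Hilbert space $X$, every dense linear subspace $D\subset X$ and every family of skew-selfadjoint operators $A(t):D\subset X\to X$, $t\in[0,T]$ (that is, $A(t)^*=-A(t)$, with domain $D$ independent of $t$), such that $t\mapsto A(t)\in\mathscr{L}(Y,X)$ is Hölder continuous of degree $\alpha$, there exists a unique evolution system for $A(t)$ on $D$. Here, in both parts, $Y$ denotes the space $D$ endowed with the graph norm of $A(0)$.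
   Context: $\mathscr{L}(Y,X)$ denotes the bounded linear operators from $Y$ to $X$ with the operator norm, and $\mathscr{L}(X)=\mathscr{L}(X,X)$; continuity, Hölder continuity and bounded variation are with respect to this norm. Definition (evolution system for $A(t)$ on $D$). Let $A(t):D\subset X\to X$, $t\in[0,T]$, be a family of closed linear operators with a time-independent dense domain $D$. A two-parameter family of operators $U(t,s)\in\mathscr{L}(X)$, $s,t\in[0,T]$ (defined on the whole square $[0,T]\times[0,T]$), is an evolution system for $A(t)$ on $D$ if: (i) $U(t,s)D\subset D$ for all $s,t\in[0,T]$, and for every $y\in D$ and $s\in[0,T]$ the map $t\mapsto x(t)=U(t,s)y$ on $[0,T]$ is a continuously differentiable (in the norm of $X$) solution of $\dot x(t)=A(t)x(t)$, $x(s)=y$; (ii) $U(s,s)=1$ and $U(t,r)U(r,s)=U(t,s)$ for all $s,r,t\in[0,T]$; (iii) $(t,s)\mapsto U(t,s)$ is strongly continuous on $[0,T]\times[0,T]$. *)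

(* Defs.v *)
(** Stdlib reals with Coquelicot.  A complex Banach space is a
    [CompleteNormedModule C_AbsRing].  An operator [D -> X] on a linear subspace
    [D : X -> Prop] is a function [X -> X] of which only the values on [D] are
    ever used; likewise a family indexed by [0,T] is a function on [R] of which
    only the values at the points of [0,T] are used. *)
From Stdlib Require Import Reals.
From Coquelicot Require Import Coquelicot.
Open Scope R_scope.

Definition in_I (T t : R) : Prop := 0 <= t <= T.

Section Operators.

Variable X : CompleteNormedModule C_AbsRing.
Implicit Types (D : X -> Prop) (B : X -> X) (N : X -> R) (A : R -> X -> X).

Definition subspace D : Prop :=
  D zero /\
  (forall x y, D x -> D y -> D (plus x y)) /\
  (forall (c : C) x, D x -> D (scal c x)).

Definition dense D : Prop :=
  forall (x : X) (eps : R), 0 < eps ->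
    exists y, D y /\ norm (minus y x) < eps.

Definition linear_on D B : Prop :=
  (forall x y, D x -> D y -> B (plus x y) = plus (B x) (B y)) /\
  (forall (c : C) x, D x -> B (scal c x) = scal c (B x)).

(** [B] belongs to L(Y,X), where Y is [D] with the norm [N]. *)
Definition bounded_operator D N B : Prop :=
  linear_on D B /\ exists M : R, forall y, D y -> norm (B y) <= M * N y.

(** The norm of [B] in L(Y,X), where Y is [D] with the norm [N].  The supremum
    is finite as soon as [bounded_operator D N B] holds; [real] sends an
    infinite one to 0. *)
Definition operator_norm D N B : R :=
  real (Lub_Rbar (fun r => exists y, D y /\ N y <= 1 /\ r = norm (B y))).

Definition graph_norm B (y : X) : R := norm y + norm (B y).

(** ||A(t) - A(s)|| in L(Y,X), where Y is [D] with the graph norm of A(0). *)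
Definition dist_YX D A (t s : R) : R :=
  operator_norm D (graph_norm (A 0)) (fun y => minus (A t y) (A s y)).

Definition family_in_LYX (T : R) D A : Prop :=
  forall t, in_I T t -> bounded_operator D (graph_norm (A 0)) (A t).

Definition continuous_LYX (T : R) D A : Prop :=
  family_in_LYX T D A /\
  forall t, in_I T t ->
    filterlim (fun s => dist_YX D A s t) (within (in_I T) (locally t)) (locally 0).

(** The points [p 0 <= ... <= p (S n)] are those of a partition in [0,T]. *)
Definition bounded_variation_LYX (T : R) D A : Prop :=
  family_in_LYX T D A /\
  exists V : R, forall (n : nat) (p : nat -> R),
    (forall k, (k <= S n)%nat -> in_I T (p k)) ->
    (forall k, (k <= n)%nat -> p k <= p (S k)) ->
    sum_n (fun k => dist_YX D A (p (S k)) (p k)) n <= V.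

(** The case [s = t] is left out because [Rpower 0 alpha] is not 0. *)
Definition holder_LYX (T alpha : R) D A : Prop :=
  family_in_LYX T D A /\
  exists L : R, forall s t, in_I T s -> in_I T t -> s <> t ->
    dist_YX D A t s <= L * Rpower (Rabs (t - s)) alpha.

Record strongly_continuous_group (G : R -> X -> X) : Prop := {
  scg_bounded : forall s, is_linear (G s);
  scg_0 : forall x, G 0 x = x;
  scg_plus : forall r s x, G (r + s) x = G r (G s x);
  scg_continuous : forall x s, continuous (fun r => G r x) s
}.

(** Equality of graphs: the domain of the generator of [G] is exactly [D]. *)
Definition is_generator D B (G : R -> X -> X) : Prop :=
  forall x y, (D x /\ B x = y) <->
    filterlim (fun h : R => scal (RtoC (/ h)) (minus (G h x) x))
      (locally' 0) (locally y).

Definition generates_group_bounded_by D B (omega : R) : Prop :=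
  exists G : R -> X -> X,
    strongly_continuous_group G /\ is_generator D B G /\
    forall s, operator_norm (fun _ => True) norm (G s) <= exp (omega * Rabs s).

(** Derivative in the norm of [X] relative to [0,T], hence one-sided at 0
    and at [T]. *)
Definition is_derive_on (T : R) (x : R -> X) (t : R) (l : X) : Prop :=
  filterlim (fun r : R => scal (RtoC (/ (r - t))) (minus (x r) (x t)))
    (within (in_I T) (locally' t)) (locally l).

Definition continuous_on_I (T : R) (x : R -> X) : Prop :=
  forall t, in_I T t -> filterlim x (within (in_I T) (locally t)) (locally (x t)).

(** Closedness of the [A t] and density of [D] are not repeated here: they
    hold for group generators with domain [D], and for skew-selfadjoint operators
    on a dense [D]. *)
Record evolution_system (T : R) D A (U : R -> R -> X -> X) : Prop := {
  es_bounded : forall t s, in_I T t -> in_I T s -> is_linear (U t s);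
  es_domain : forall t s y, in_I T t -> in_I T s -> D y -> D (U t s y);
  es_derive : forall s t y, in_I T s -> in_I T t -> D y ->
    is_derive_on T (fun r => U r s y) t (A t (U t s y));
  es_C1 : forall s y, in_I T s -> D y ->
    continuous_on_I T (fun t => A t (U t s y));
  es_id : forall s x, in_I T s -> U s s x = x;
  es_comp : forall t r s x, in_I T t -> in_I T r -> in_I T s ->
    U t r (U r s x) = U t s x;
  es_strong_continuity : forall x t s, in_I T t -> in_I T s ->
    filterlim (fun p : R * R => U (fst p) (snd p) x)
      (within (fun p : R * R => in_I T (fst p) /\ in_I T (snd p)) (locally (t, s)))
      (locally (U t s x))
}.

(** Uniqueness is equality of the operators on the square [0,T] x [0,T]. *)
Definition exists_unique_evolution_system (T : R) D A : Prop :=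
  exists U, evolution_system T D A U /\
    forall U', evolution_system T D A U' ->
      forall t s, in_I T t -> in_I T s -> forall x, U' t s x = U t s x.

End Operators.

Arguments subspace {X} D.
Arguments dense {X} D.
Arguments linear_on {X} D B.
Arguments bounded_operator {X} D N B.
Arguments operator_norm {X} D N B.
Arguments graph_norm {X} B y.
Arguments dist_YX {X} D A t s.
Arguments family_in_LYX {X} T D A.
Arguments continuous_LYX {X} T D A.
Arguments bounded_variation_LYX {X} T D A.
Arguments holder_LYX {X} T alpha D A.
Arguments strongly_continuous_group {X} G.
Arguments is_generator {X} D B G.
Arguments generates_group_bounded_by {X} D B omega.
Arguments is_derive_on {X} T x t l.
Arguments continuous_on_I {X} T x.
Arguments evolution_system {X} T D A U.
Arguments exists_unique_evolution_system {X} T D A.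

(** A complex Banach space whose norm comes from an inner product, linear in the
    first argument; positivity is contained in [inner_norm]. *)
Record HilbertSpace := {
  hilbert_banach :> CompleteNormedModule C_AbsRing;
  inner : hilbert_banach -> hilbert_banach -> C;
  inner_plus : forall x y z, inner (plus x y) z = Cplus (inner x z) (inner y z);
  inner_scal : forall (c : C) x y, inner (scal c x) y = Cmult c (inner x y);
  inner_conj : forall x y, inner y x = Cconj (inner x y);
  inner_norm : forall x, inner x x = RtoC (norm x * norm x)
}.

Arguments inner {_} _ _.

(** [(x, z)] is in the graph of the adjoint of the densely defined [B]. *)
Definition adjoint_graph {X : HilbertSpace} (D : X -> Prop) (B : X -> X)
    (x z : X) : Prop :=
  forall y, D y -> inner (B y) x = inner y z.

Definition skew_selfadjoint {X : HilbertSpace} (D : X -> Prop) (B : X -> X) : Prop :=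
  linear_on D B /\
  forall x z, adjoint_graph D B x z <-> (D x /\ z = opp (B x)).

(* Main.v *)
Require Import Defs.
From Stdlib Require Import Reals Lra Lia Psatz.
From Stdlib Require Import Classical ClassicalEpsilon FunctionalExtensionality PropExtensionality ProofIrrelevance.
From Coquelicot Require Import Coquelicot.
Open Scope R_scope.

(** Both counterexamples perturb a diagonal operator resonantly.  A solution of
    [x' = i w x + e^(iwt) g(t)] has [(e^(-iwt) x)' = g], so the forcing
    accumulates without oscillating.

    (a) On [c_0] let [x_n' = i n x_n + n^-1 e^(int) x_0] and [x_0' = 0].  The
    coupling is Lipschitz in [t], and [A(t)] is similar to [diag(i n)], which makes
    its group explicit.  The solution starting at [e_0] has [|n x_n(t)| = t] for
    [n >= 1], so it has left the domain [{x | n x_n -> 0}].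

    (b) On a direct sum of copies of C^2 take the blocks
    [[0, - e_k e^(-i w_k t)], [e_k e^(i w_k t), i w_k]] with [e_k = w_k^(-alpha)], which
    makes the coupling Hoelder continuous of degree [alpha].  Starting at [(c_k, 0)],
    the second component has modulus [|sin (e_k t) c_k|].  For [w_k^(1-alpha) = k + 1] and
    [c_k = 1 / (k + 1)], multiplying it by [w_k] gives at [t = 1] a sequence bounded
    away from 0, so the solution has left the domain. *)

(** * Banach spaces of families of complex numbers *)

(** Existence itself is refuted: [es_id] and [es_derive] determine enough of a trajectory to
    contradict [es_domain] at [t = 1]. Each block is finite-dimensional, so real and imaginary parts
    of single coordinates and the mean value theorem suffice.

    The couplings have critical size. In (a) the formal derivative of n^-1 e^(int) is i e^(int),
    bounded but not tending to 0: the coupling is Lipschitz yet not differentiable as a map into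
    c_0, and resonance turns this defect into a bounded sequence n x_n outside c_0. The group bound
    must have constant 1 at s = 0; similarity to diag(i n) alone would give a constant ||S||
    ||S^-1||, so the norm is estimated on the explicit formula.

    In (b) a bounded multiplier would map l^2 to itself, so w_k e_k has to be unbounded. As |e^(iwt)
    - e^(iws)| is at most min(2, w |t - s|), the size w^-alpha keeps the Hoelder constant uniform in
    w, and alpha < 1 leaves w_k e_k = w_k^(1-alpha) free to grow. *)

(** The norm of the space is the supremum of the seminorms [semi m]. *)
Record family_space (I : Type) := {
  member : (I -> C) -> Prop;
  semi : nat -> (I -> C) -> R;
  member_zero : member (fun _ => RtoC 0);
  member_plus : forall x y, member x -> member y ->
    member (fun i => Cplus (x i) (y i));
  member_scal : forall c x, member x -> member (fun i => Cmult c (x i));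
  semi_ge_0 : forall m x, 0 <= semi m x;
  semi_plus : forall m x y,
    semi m (fun i => Cplus (x i) (y i)) <= semi m x + semi m y;
  semi_scal : forall m c x, semi m (fun i => Cmult c (x i)) <= Cmod c * semi m x;
  semi_coord : forall i, exists m, forall x, Cmod (x i) <= semi m x;
  semi_pointwise : forall m (F : ((I -> C) -> Prop) -> Prop), Filter F ->
    (forall i (d : posreal), F (fun x => Cmod (x i) < d)) ->
    forall e : posreal, F (fun x => semi m x < e);
  member_bounded : forall x, member x -> exists M, forall m, semi m x <= M;
  member_closed : forall x,
    (forall e : posreal, exists y, member y /\
       forall m, semi m (fun i => Cminus (x i) (y i)) <= e) ->
    member x
}.

Arguments member {I} f x.
Arguments semi {I} f m x.

Definition family {I : Type} (S : family_space I) := {x : I -> C | member S x}.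

Definition coord {I : Type} {S : family_space I} (x : family S) : I -> C := proj1_sig x.

Ltac C_ring := apply injective_projections; unfold coord; simpl; ring.

Section FamilySpace.

Context {I : Type} (S : family_space I).

Lemma coord_inj (x y : family S) : (forall i, coord x i = coord y i) -> x = y.
Proof.
  destruct x as [x hx], y as [y hy]; simpl; intros h.
  assert (e : x = y) by (apply functional_extensionality; exact h).
  subst y; f_equal; apply proof_irrelevance.
Qed.

Definition family_zero : family S := exist _ _ (member_zero _ S).

Definition family_plus (x y : family S) : family S :=
  exist _ _ (member_plus _ S _ _ (proj2_sig x) (proj2_sig y)).

Definition family_scal (c : C) (x : family S) : family S :=
  exist _ _ (member_scal _ S c _ (proj2_sig x)).

(** The junk value outside [member S] is [0]. *)
Definition make (x : I -> C) : family S :=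
  match excluded_middle_informative (member S x) with
  | left h => exist _ x h
  | right _ => family_zero
  end.

Lemma coord_make x : member S x -> coord (make x) = x.
Proof. unfold make; destruct excluded_middle_informative; easy. Qed.

Definition family_opp (x : family S) : family S := family_scal (RtoC (-1)) x.

Definition family_AbelianMonoid_mixin : AbelianMonoid.mixin_of (family S).
Proof.
  apply (AbelianMonoid.Mixin _ family_plus family_zero);
    intros; apply coord_inj; intros i; C_ring.
Defined.

Canonical family_AbelianMonoid := AbelianMonoid.Pack (family S) family_AbelianMonoid_mixin (family S).

Definition family_AbelianGroup_mixin : AbelianGroup.mixin_of family_AbelianMonoid.
Proof.
  apply (AbelianGroup.Mixin family_AbelianMonoid family_opp).
  intros; apply coord_inj; intros i; C_ring.
Defined.

Canonical family_AbelianGroup := AbelianGroup.Pack (family S)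
  (AbelianGroup.Class _ _ family_AbelianGroup_mixin) (family S).

Definition family_ModuleSpace_mixin :
  ModuleSpace.mixin_of C_Ring family_AbelianGroup.
Proof.
  apply (ModuleSpace.Mixin C_Ring family_AbelianGroup family_scal);
    intros; apply coord_inj; intros i; C_ring.
Defined.

Canonical family_ModuleSpace := ModuleSpace.Pack C_Ring (family S)
  (ModuleSpace.Class C_Ring _ _ family_ModuleSpace_mixin) (family S).

Definition family_norm (x : family S) : R :=
  real (Lub_Rbar (fun r => exists m, r = semi S m (coord x))).

(** The norm is the [real] part of a supremum, so it is meaningful because that supremum is finite:
    [member_bounded] bounds it from above, the seminorm of index 0 from below. *)
Lemma family_norm_lub x :
  is_lub_Rbar (fun r => exists m, r = semi S m (coord x)) (family_norm x).
Proof.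
  unfold family_norm.
  set (E := fun r => exists m, r = semi S m (coord x)).
  destruct (Lub_Rbar_correct E) as [hu hl].
  destruct (member_bounded _ S _ (proj2_sig x)) as [M hM].
  assert (h1 : Rbar_le (Lub_Rbar E) M).
  { apply hl; intros r [m ->]; apply hM. }
  assert (h2 : Rbar_le (semi S 0 (coord x)) (Lub_Rbar E)).
  { apply hu; exists 0%nat; reflexivity. }
  destruct (Lub_Rbar E) as [l| |]; try easy.
Qed.

Lemma semi_le_norm m x : semi S m (coord x) <= family_norm x.
Proof. apply (proj1 (family_norm_lub x)); exists m; reflexivity. Qed.

Lemma norm_le_of_semi x M :
  (forall m, semi S m (coord x) <= M) -> family_norm x <= M.
Proof. intros h; apply (proj2 (family_norm_lub x) M); intros r [m ->]; apply h. Qed.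

Lemma coord_le_norm x i : Cmod (coord x i) <= family_norm x.
Proof.
  destruct (semi_coord _ S i) as [m hm].
  eapply Rle_trans; [apply hm | apply semi_le_norm].
Qed.

Definition family_ball (x : family S) (e : R) (y : family S) : Prop :=
  family_norm (minus y x) < e.

Lemma family_norm_plus x y :
  family_norm (plus x y) <= family_norm x + family_norm y.
Proof.
  apply norm_le_of_semi; intros m.
  eapply Rle_trans; [apply semi_plus |].
  apply Rplus_le_compat; apply semi_le_norm.
Qed.

Lemma family_norm_scal (c : C) x :
  family_norm (scal c x) <= Cmod c * family_norm x.
Proof.
  apply norm_le_of_semi; intros m.
  eapply Rle_trans; [apply semi_scal |].
  apply Rmult_le_compat_l; [apply Cmod_ge_0 | apply semi_le_norm].
Qed.

Lemma family_norm_opp x : family_norm (opp x) <= family_norm x.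
Proof.
  change (opp x) with (scal (RtoC (-1)) x).
  eapply Rle_trans; [apply family_norm_scal |].
  rewrite Cmod_R, Rabs_left; lra.
Qed.

Definition family_UniformSpace_mixin : UniformSpace.mixin_of (family S).
Proof.
  apply (UniformSpace.Mixin _ family_zero family_ball); unfold family_ball.
  - intros x e.
    apply Rle_lt_trans with 0; [| apply cond_pos].
    rewrite minus_eq_zero.
    apply norm_le_of_semi; intros m.
    assert (h := semi_scal _ S m (RtoC 0) (fun _ => RtoC 0)).
    rewrite Cmod_0, Rmult_0_l, Cmult_0_l in h; exact h.
  - intros x y e h.
    rewrite <- opp_minus.
    eapply Rle_lt_trans; [apply family_norm_opp | exact h].
  - intros x y z e1 e2 h1 h2.
    rewrite (minus_trans y).
    eapply Rle_lt_trans; [apply family_norm_plus |]; lra.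
Defined.

Canonical family_UniformSpace :=
  UniformSpace.Pack (family S) family_UniformSpace_mixin (family S).

Canonical family_NormedModuleAux := NormedModuleAux.Pack C_AbsRing (family S)
  (NormedModuleAux.Class C_AbsRing _ (ModuleSpace.class _ family_ModuleSpace)
     family_UniformSpace_mixin) (family S).

Definition family_NormedModule_mixin :
  NormedModule.mixin_of C_AbsRing family_NormedModuleAux.
Proof.
  apply (NormedModule.Mixin C_AbsRing family_NormedModuleAux family_norm 1).
  - exact family_norm_plus.
  - exact family_norm_scal.
  - easy.
  - intros x y e h; rewrite Rmult_1_l; exact h.
  - intros x h; apply coord_inj; intros i.
    apply Cmod_eq_0, Rle_antisym; [| apply Cmod_ge_0].
    rewrite <- h; apply coord_le_norm.
Defined.

Canonical family_NormedModule := NormedModule.Pack C_AbsRing (family S)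
  (NormedModule.Class C_AbsRing _ _ family_NormedModule_mixin) (family S).

Definition pointwise_lim (F : (family S -> Prop) -> Prop) : I -> C :=
  fun i => lim (T := C_CompleteNormedModule) (filtermap (fun x => coord x i) F).

Lemma pointwise_lim_correct F : ProperFilter F -> cauchy F ->
  forall i (d : posreal), F (fun x => Cmod (Cminus (coord x i) (pointwise_lim F i)) < d).
Proof.
  intros PF cF i d.
  set (G := filtermap (fun x => coord x i) F).
  assert (PG : ProperFilter G) by now apply filtermap_proper_filter.
  assert (cG : cauchy (T := C_UniformSpace) G).
  { intros e; destruct (cF e) as [a ha]; exists (coord a i).
    unfold G, filtermap; revert ha; apply filter_imp; intros x hx.
    apply (norm_compat1 (V := C_NormedModule)).
    eapply Rle_lt_trans; [| exact hx].
    eapply Rle_trans; [apply Req_le | apply (coord_le_norm (minus x a) i)].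
    change (Cmod (minus (coord x i) (coord a i)) = Cmod (coord (minus x a) i)).
    f_equal; C_ring. }
  (* Balls in [C] are squares in the two real coordinates; passing to the modulus costs a factor
     [sqrt 2]. *)
  assert (hd : 0 < d / sqrt 2).
  { apply Rdiv_lt_0_compat; [apply cond_pos | apply sqrt_lt_R0; lra]. }
  assert (h := complete_cauchy (T := C_CompleteNormedModule) G PG cG (mkposreal _ hd)).
  revert h; unfold G at 1, filtermap; apply filter_imp; intros x hx.
  apply C_NormedModule_mixin_compat2 in hx; simpl in hx.
  replace (pos d) with (sqrt 2 * (d / sqrt 2)); [exact hx |].
  field; apply Rgt_not_eq, sqrt_lt_R0; lra.
Qed.

(** Insert a point [x] of the filter: the part [x - a] is below [e], and the part
    [pointwise_lim F - x] is arbitrarily small by [semi_pointwise], since coordinatewise convergence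
    controls each single seminorm. The bound is uniform in [m], so it survives the supremum. *)
Lemma pointwise_lim_close F (PF : ProperFilter F) (cF : cauchy F) (e : posreal) (a : family S) :
  F (ball a e) ->
  forall m, semi S m (fun i => Cminus (pointwise_lim F i) (coord a i)) <= e.
Proof.
  intros ha m; apply le_epsilon; intros d hd.
  assert (h : F (fun x => semi S m (fun i => Cminus (pointwise_lim F i) (coord x i)) < d)).
  { apply (semi_pointwise _ S m
      (filtermap (fun x i => Cminus (pointwise_lim F i) (coord x i)) F)
      (filtermap_filter _ _ _ _ filter_filter)) with (e := mkposreal d hd).
    intros i d'; unfold filtermap.
    generalize (pointwise_lim_correct F PF cF i d'); apply filter_imp; intros x hx.
    rewrite <- Cmod_opp, Copp_minus_distr; exact hx. }
  destruct (filter_ex _ (filter_and _ _ h ha)) as [x [h1 h2]].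
  simpl in h1; change (family_norm (minus x a) < e) in h2.
  replace (fun i => Cminus (pointwise_lim F i) (coord a i)) with
    (fun i => Cplus (coord (minus x a) i) (Cminus (pointwise_lim F i) (coord x i))).
  - eapply Rle_trans; [apply semi_plus |].
    assert (h3 := semi_le_norm m (minus x a)); lra.
  - apply functional_extensionality; intros i.
    C_ring.
Qed.

Definition family_CompleteSpace_mixin : CompleteSpace.mixin_of family_UniformSpace.
Proof.
  apply (CompleteSpace.Mixin family_UniformSpace (fun F => make (pointwise_lim F))).
  - intros F PF cF.
    assert (hm : member S (pointwise_lim F)).
    { apply member_closed; intros e.
      destruct (cF e) as [a ha]; exists (coord a); split; [apply (proj2_sig a) |].
      now apply pointwise_lim_close. }
    intros e.
    assert (he : 0 < e / 3) by (assert (h := cond_pos e); lra).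
    destruct (cF (mkposreal _ he)) as [a ha].
    assert (h := pointwise_lim_close F PF cF _ a ha); simpl in h.
    revert ha; apply filter_imp; intros x hx.
    assert (hx' : family_norm (minus x a) < e / 3) by exact hx.
    set (z := make (pointwise_lim F)).
    assert (hz : coord z = pointwise_lim F) by now apply coord_make.
    clearbody z.
    change (family_norm (minus x z) < e).
    rewrite (minus_trans a).
    eapply Rle_lt_trans; [apply family_norm_plus |].
    rewrite <- (opp_minus z a).
    assert (h4 := family_norm_opp (minus z a)).
    assert (h5 : family_norm (minus z a) <= e / 3).
    { apply norm_le_of_semi; intros m.
      eapply Rle_trans; [apply Req_le | apply (h m)].
      f_equal; apply functional_extensionality; intros i.
      rewrite <- hz; C_ring. }
    lra.
  (* Filters finer than each other are equal by extensionality, hence have the same limit. *)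
  - intros F1 F2 h1 h2.
    replace F2 with F1; [apply close_refl |].
    apply functional_extensionality; intros P; apply propositional_extensionality.
    split; [apply h2 | apply h1].
Defined.

Canonical family_CompleteNormedModule := CompleteNormedModule.Pack C_AbsRing (family S)
  (CompleteNormedModule.Class C_AbsRing _ (NormedModule.class _ family_NormedModule)
     family_CompleteSpace_mixin) (family S).

End FamilySpace.

Arguments coord {I} S x.

(** * Perturbation estimates in L(Y,X) *)

Section OperatorNorm.

Context {X : CompleteNormedModule C_AbsRing} (D : X -> Prop).

(** The condition [0 <= M] covers an empty supremum, which is [m_infty] and becomes 0 under
    [real]. *)
Lemma operator_norm_le (N : X -> R) (B : X -> X) (M : R) :
  0 <= M -> (forall y, D y -> N y <= 1 -> norm (B y) <= M) ->
  operator_norm D N B <= M.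
Proof.
  intros hM h; unfold operator_norm.
  set (E := fun r => exists y, D y /\ N y <= 1 /\ r = norm (B y)).
  destruct (Lub_Rbar_correct E) as [_ hl].
  assert (h1 : Rbar_le (Lub_Rbar E) M).
  { apply hl; intros r [y [hy [hN ->]]]; simpl; auto. }
  destruct (Lub_Rbar E); simpl in *; easy.
Qed.

Lemma operator_norm_ge_0 (N : X -> R) (B : X -> X) : 0 <= operator_norm D N B.
Proof.
  unfold operator_norm.
  set (E := fun r => exists y, D y /\ N y <= 1 /\ r = norm (B y)).
  destruct (Lub_Rbar_correct E) as [hu hl].
  destruct (excluded_middle_informative (exists r, E r)) as [[r hr] | hE].
  - assert (h := hu r hr).
    assert (h0 : 0 <= r) by (destruct hr as [y [_ [_ ->]]]; apply norm_ge_0).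
    destruct (Lub_Rbar E); simpl in *; lra.
  - assert (h : Rbar_le (Lub_Rbar E) m_infty).
    { apply hl; intros r hr; exfalso; eauto. }
    destruct (Lub_Rbar E); simpl in *; try easy; lra.
Qed.

Variables (T : R) (A : R -> X -> X) (K : R -> R -> R).
Hypothesis K_ge_0 : forall t s, 0 <= K t s.
Hypothesis A_close : forall t s, in_I T t -> in_I T s -> forall y, D y ->
  norm (minus (A t y) (A s y)) <= K t s * norm y.

(** The graph norm dominates the norm of [X], so an estimate in L(X) is stronger than one in L(Y,X).
    Both examples vary by bounded operators only. *)
Lemma dist_YX_le t s : in_I T t -> in_I T s -> dist_YX D A t s <= K t s.
Proof.
  intros ht hs; apply operator_norm_le; [apply K_ge_0 |].
  intros y hy; unfold graph_norm; intros hN.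
  eapply Rle_trans; [apply A_close; assumption |].
  rewrite <- (Rmult_1_r (K t s)) at 2; apply Rmult_le_compat_l; [apply K_ge_0 |].
  assert (h := norm_ge_0 (A 0 y)); lra.
Qed.

(** [A t] is [A 0] plus an operator bounded by [K t 0], and [A 0] has norm at most 1 for its own
    graph norm. *)
Lemma perturbation_in_LYX :
  0 <= T -> (forall t, in_I T t -> linear_on D (A t)) -> family_in_LYX T D A.
Proof.
  intros hT hlin t ht; split; [now apply hlin |].
  exists (1 + K t 0); intros y hy; unfold graph_norm.
  assert (h0 : in_I T 0) by (split; lra).
  assert (h1 := A_close t 0 ht h0 y hy).
  assert (h2 : norm (A t y) <= norm (minus (A t y) (A 0 y)) + norm (A 0 y)).
  { eapply Rle_trans; [| apply norm_triangle].
    apply Req_le; f_equal; unfold minus.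
    symmetry; etransitivity; [symmetry; apply plus_assoc |].
    etransitivity; [apply f_equal, (plus_opp_l (G := X)) | apply plus_zero_r]. }
  assert (h3 := norm_ge_0 y); assert (h4 := norm_ge_0 (A 0 y)).
  assert (h5 := K_ge_0 t 0); nra.
Qed.

End OperatorNorm.

(** * Derivatives on a closed interval *)

(** The projection of the line onto [0,T]. Composing with it extends a trajectory to all of [R], so
    that two-sided continuity and the mean value theorem apply without treating the endpoints
    apart. *)
Definition clamp (T r : R) : R := Rmax 0 (Rmin T r).

Lemma clamp_in_I T r : 0 <= T -> in_I T (clamp T r).
Proof.
  intros hT; unfold clamp, in_I, Rmax, Rmin.
  destruct (Rle_dec T r); destruct Rle_dec; lra.
Qed.

Lemma clamp_id T r : in_I T r -> clamp T r = r.
Proof.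
  unfold clamp, in_I, Rmax, Rmin; intros h.
  destruct (Rle_dec T r); destruct Rle_dec; lra.
Qed.

Lemma clamp_lipschitz T r s : 0 <= T -> Rabs (clamp T r - clamp T s) <= Rabs (r - s).
Proof.
  intros hT; unfold clamp, Rmax, Rmin.
  destruct (Rle_dec T r); destruct (Rle_dec T s);
    repeat destruct Rle_dec; unfold Rabs; repeat destruct Rcase_abs; lra.
Qed.

Section RealFunctional.

Context {X : CompleteNormedModule C_AbsRing}.

(** Real-linear contractions, used to turn derivatives in [X] into derivatives of real functions. *)
Record real_functional (f : X -> R) : Prop := {
  rf_minus : forall x y, f (minus x y) = f x - f y;
  rf_scal : forall c x, f (scal (RtoC c) x) = c * f x;
  rf_norm : forall x, Rabs (f x) <= norm x
}.

Variables (f : X -> R) (T : R) (x : R -> X).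
Hypothesis hf : real_functional f.

(** The difference quotient multiplied out. In this form [r = t] is allowed, and the same estimate
    yields differentiability inside the interval and continuity up to the ends. *)
Lemma functional_taylor t l : is_derive_on T x t l ->
  forall e : posreal, exists d : posreal, forall r, in_I T r -> Rabs (r - t) < d ->
    Rabs (f (x r) - f (x t) - f l * (r - t)) <= e * Rabs (r - t).
Proof.
  intros h e.
  assert (hl : locally l (fun y => norm (minus y l) < e)).
  { apply (locally_le_locally_norm (V := X) l); exists e; intros y hy; exact hy. }
  destruct (h _ hl) as [d hd]; exists d; intros r hr hrd.
  destruct (Req_dec r t) as [-> | hne].
  { replace (f (x t) - f (x t) - f l * (t - t)) with 0 by ring.
    rewrite Rabs_R0; apply Rmult_le_pos; [apply Rlt_le, cond_pos | apply Rabs_pos]. }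
  assert (hn := hd r hrd hne hr); simpl in hn.
  assert (h1 := rf_norm f hf (minus (scal (RtoC (/ (r - t))) (minus (x r) (x t))) l)).
  rewrite !(rf_minus f hf), (rf_scal f hf), (rf_minus f hf) in h1.
  assert (hrt : r - t <> 0) by lra.
  replace (f (x r) - f (x t) - f l * (r - t)) with
    ((/ (r - t) * (f (x r) - f (x t)) - f l) * (r - t)) by (field; exact hrt).
  rewrite Rabs_mult; apply Rmult_le_compat_r; [apply Rabs_pos |].
  eapply Rle_trans; [exact h1 | apply Rlt_le, hn].
Qed.

Lemma functional_is_derive t l : 0 < t < T -> is_derive_on T x t l ->
  is_derive (fun r => f (x (clamp T r))) t (f l).
Proof.
  intros ht h; apply is_derive_Reals; intros e he.
  assert (he2 : 0 < e / 2) by lra.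
  destruct (functional_taylor t l h (mkposreal _ he2)) as [d hd].
  (* The distances to the endpoints keep [t + k] in [0,T], where [clamp] is the identity. *)
  assert (hd' : 0 < Rmin d (Rmin t (T - t))).
  { repeat apply Rmin_glb_lt; try lra; apply cond_pos. }
  exists (mkposreal _ hd'); intros k hk hkd; simpl in hkd.
  assert (hk1 := Rlt_le_trans _ _ _ hkd (Rmin_l _ _)).
  assert (hk2 := Rlt_le_trans _ _ _ hkd (Rmin_r _ _)).
  assert (hk3 := Rlt_le_trans _ _ _ hk2 (Rmin_l _ _)).
  assert (hk4 := Rlt_le_trans _ _ _ hk2 (Rmin_r _ _)).
  assert (hI : in_I T (t + k)).
  { unfold in_I; unfold Rabs in hk3, hk4; destruct (Rcase_abs k); lra. }
  rewrite !clamp_id by (assumption || (unfold in_I; lra)).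
  assert (h1 := hd (t + k) hI); replace (t + k - t) with k in h1 by ring.
  specialize (h1 hk1); simpl in h1.
  replace ((f (x (t + k)) - f (x t)) / k - f l) with
    ((f (x (t + k)) - f (x t) - f l * k) / k) by (field; exact hk).
  unfold Rdiv; rewrite Rabs_mult, Rabs_inv.
  assert (hkp : 0 < Rabs k) by now apply Rabs_pos_lt.
  apply Rle_lt_trans with (e / 2); [| lra].
  apply Rmult_le_reg_r with (Rabs k); [exact hkp |].
  rewrite Rmult_assoc, Rinv_l by lra; lra.
Qed.

Lemma functional_continuity : 0 <= T ->
  (forall t, in_I T t -> exists l, is_derive_on T x t l) ->
  forall r, continuity_pt (fun r => f (x (clamp T r))) r.
Proof.
  intros hT h r.
  apply continuity_pt_filterlim, filterlim_locally; intros e.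
  destruct (h _ (clamp_in_I T r hT)) as [l hl].
  destruct (functional_taylor _ l hl (mkposreal 1 Rlt_0_1)) as [d hd]; simpl in hd.
  assert (hl0 := Rabs_pos (f l)).
  assert (hd' : 0 < Rmin d (e / (2 + Rabs (f l)))).
  { apply Rmin_glb_lt; [apply cond_pos |].
    apply Rdiv_lt_0_compat; [apply cond_pos | lra]. }
  exists (mkposreal _ hd'); intros s hs.
  change (Rabs (s - r) < Rmin d (e / (2 + Rabs (f l)))) in hs.
  change (Rabs (f (x (clamp T s)) - f (x (clamp T r))) < e).
  assert (hc := clamp_lipschitz T s r hT).
  assert (hs1 := Rlt_le_trans _ _ _ hs (Rmin_l _ _)).
  assert (hs2 := Rlt_le_trans _ _ _ hs (Rmin_r _ _)).
  assert (h1 := hd _ (clamp_in_I T s hT) (Rle_lt_trans _ _ _ hc hs1)).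
  set (c := clamp T s - clamp T r) in *.
  replace (f (x (clamp T s)) - f (x (clamp T r))) with
    ((f (x (clamp T s)) - f (x (clamp T r)) - f l * c) + f l * c) by ring.
  eapply Rle_lt_trans; [apply Rabs_triang |]; rewrite Rabs_mult.
  assert (h2 : (2 + Rabs (f l)) * Rabs (s - r) < e).
  { apply Rmult_lt_reg_r with (/ (2 + Rabs (f l))); [apply Rinv_0_lt_compat; lra |].
    replace ((2 + Rabs (f l)) * Rabs (s - r) * / (2 + Rabs (f l))) with (Rabs (s - r))
      by (field; lra).
    exact hs2. }
  assert (h3 := Rabs_pos c); assert (h4 := Rabs_pos (s - r)); nra.
Qed.

End RealFunctional.

Lemma eq_of_is_derive_0 (f : R -> R) (T : R) : 0 < T ->
  (forall t, continuity_pt f t) -> (forall t, 0 < t < T -> is_derive f t 0) ->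
  f T = f 0.
Proof.
  intros hT hc hd.
  destruct (MVT_gen f 0 T (fun _ => 0)) as [c [_ h]];
    rewrite ?Rmin_left, ?Rmax_right by lra; auto.
  lra.
Qed.

Lemma Re_functional {I} (S : family_space I) i :
  real_functional (X := family_CompleteNormedModule S) (fun x => Re (coord S x i)).
Proof.
  split.
  - intros x y; unfold coord, Re; simpl; ring.
  - intros c x; unfold coord, Re; simpl; ring.
  - intros x; eapply Rle_trans; [apply re_le_Cmod | apply coord_le_norm].
Qed.

Lemma Im_functional {I} (S : family_space I) i :
  real_functional (X := family_CompleteNormedModule S) (fun x => Im (coord S x i)).
Proof.
  split.
  - intros x y; unfold coord, Im; simpl; ring.
  - intros c x; unfold coord, Im; simpl; ring.
  - intros x; eapply Rle_trans; [| apply coord_le_norm].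
    eapply Rle_trans; [apply Rmax_r | apply Rmax_Cmod].
Qed.

(** * Removing the oscillation by a rotating frame *)

Definition cis (a : R) : C := (cos a, sin a).

Section RotatingFrame.

Context {I : Type} (S : family_space I) (T w e : R) (i j : I).
Variable x : R -> family_CompleteNormedModule S.
Variable l : R -> family_CompleteNormedModule S.
Hypothesis T_gt_0 : 0 < T.
Hypothesis hx : forall t, in_I T t -> is_derive_on T x t (l t).
Hypothesis hl : forall t, in_I T t -> coord S (l t) i =
  Cplus (Cmult (RtoC e) (Cmult (cis (w * t)) (coord S (x t) j)))
        (Cmult (0, w) (coord S (x t) i)).

(** [Re (e^(-iwt) x_i)]. *)
Definition rotating (t : R) : R :=
  cos (w * t) * Re (coord S (x (clamp T t)) i) + sin (w * t) * Im (coord S (x (clamp T t)) i).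

Lemma rotating_is_derive t : 0 < t < T ->
  is_derive rotating t (e * Re (coord S (x (clamp T t)) j)).
Proof.
  intros ht.
  assert (hI : in_I T t) by (unfold in_I; lra).
  assert (h1 := functional_is_derive _ T x (Re_functional S i) t _ ht (hx t hI)).
  assert (h2 := functional_is_derive _ T x (Im_functional S i) t _ ht (hx t hI)).
  cbv beta in h1, h2; rewrite (hl t hI) in h1, h2.
  unfold rotating; rewrite (clamp_id T t hI).
  set (p := fun r : R => Re (coord S (x (clamp T r)) i)).
  set (q := fun r : R => Im (coord S (x (clamp T r)) i)).
  change (is_derive p t (Re (Cplus (Cmult (RtoC e) (Cmult (cis (w * t)) (coord S (x t) j)))
        (Cmult (0, w) (coord S (x t) i))))) in h1.
  change (is_derive q t (Im (Cplus (Cmult (RtoC e) (Cmult (cis (w * t)) (coord S (x t) j)))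
        (Cmult (0, w) (coord S (x t) i))))) in h2.
  change (is_derive (fun t => cos (w * t) * p t + sin (w * t) * q t) t
            (e * Re (coord S (x t) j))).
  assert (hp : p t = Re (coord S (x t) i)) by (unfold p; now rewrite clamp_id).
  assert (hq : q t = Im (coord S (x t) i)) by (unfold q; now rewrite clamp_id).
  clearbody p q.
  auto_derive; [split; [eexists; exact h1 | split; [eexists; exact h2 | easy]] |].
  replace (Derive (fun x => p x) t) with (Derive p t) by reflexivity.
  replace (Derive (fun x => q x) t) with (Derive q t) by reflexivity.
  rewrite (is_derive_unique _ _ _ h1), (is_derive_unique _ _ _ h2), hp, hq.
  assert (hcs := sin2_cos2 (w * t)); unfold Rsqr in hcs.
  destruct (coord S (x t) i) as [a b]; destruct (coord S (x t) j) as [c d].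
  unfold cis, Re, Im; simpl.
  transitivity (e * c * (sin (w * t) * sin (w * t) + cos (w * t) * cos (w * t))); [ring |].
  rewrite hcs; ring.
Qed.

Lemma rotating_continuity t : continuity_pt rotating t.
Proof.
  assert (hd : forall t, in_I T t -> exists l, is_derive_on T x t l) by eauto.
  assert (h1 := functional_continuity _ T x (Re_functional S i) (Rlt_le _ _ T_gt_0) hd t).
  assert (h2 := functional_continuity _ T x (Im_functional S i) (Rlt_le _ _ T_gt_0) hd t).
  apply (continuity_pt_plus (fun t => _ * _) (fun t => _ * _));
    apply (continuity_pt_mult (fun t => _) (fun t => _)); try assumption; reg.
Qed.

Lemma rotating_0 : rotating 0 = Re (coord S (x 0) i).
Proof.
  unfold rotating; rewrite clamp_id by (unfold in_I; lra).
  rewrite Rmult_0_r, cos_0, sin_0; ring.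
Qed.

(** [rotating] is the real part of a number with the same modulus as the coordinate; the square
    dropped is that of the imaginary part. Lower bounds on moduli thus need only this real part. *)
Lemma rotating_le_Cmod t : in_I T t -> rotating t <= Cmod (coord S (x t) i).
Proof.
  intros ht; unfold rotating; rewrite clamp_id by exact ht.
  destruct (coord S (x t) i) as [a b]; unfold Re, Im, Cmod; simpl.
  apply Rle_trans with (Rabs (cos (w * t) * a + sin (w * t) * b)); [apply Rle_abs |].
  rewrite <- sqrt_Rsqr_abs; apply sqrt_le_1_alt; unfold Rsqr.
  assert (h := sin2_cos2 (w * t)); unfold Rsqr in h.
  replace (a * (a * 1) + b * (b * 1)) with
    ((a * a + b * b) * (sin (w * t) * sin (w * t) + cos (w * t) * cos (w * t)))
    by (rewrite h; ring).
  assert (h1 := Rle_0_sqr (cos (w * t) * b - sin (w * t) * a)); unfold Rsqr in h1; nra.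
Qed.

End RotatingFrame.

(** * Estimates on the unit circle *)

Lemma Rabs_sin_le a : Rabs (sin a) <= Rabs a.
Proof.
  destruct (MVT_gen sin 0 a cos) as [c [_ h]].
  - intros y _; apply is_derive_Reals, derivable_pt_lim_sin.
  - intros y _; apply continuity_sin.
  - rewrite sin_0, !Rminus_0_r in h; rewrite h, Rabs_mult.
    assert (h1 : Rabs (cos c) <= 1) by (apply Rabs_le, COS_bound).
    assert (h2 := Rabs_pos a); nra.
Qed.

Lemma one_minus_cos a : 1 - cos a = 2 * (sin (a / 2) * sin (a / 2)).
Proof.
  replace (cos a) with (cos (2 * (a / 2))) by (f_equal; field).
  rewrite cos_2a_sin; ring.
Qed.

Lemma Cmod_cis a : Cmod (cis a) = 1.
Proof.
  unfold Cmod, cis; simpl; rewrite !Rmult_1_r.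
  assert (h := sin2_cos2 a); unfold Rsqr in h.
  rewrite Rplus_comm, h; apply sqrt_1.
Qed.

Lemma cis_plus a b : cis (a + b) = Cmult (cis a) (cis b).
Proof.
  unfold cis, Cmult; simpl; rewrite cos_plus, sin_plus; f_equal; ring.
Qed.

Lemma cis_0 : cis 0 = RtoC 1.
Proof. unfold cis; rewrite cos_0, sin_0; reflexivity. Qed.

(** The chord has length 2 |sin (a / 2)|. *)
Lemma Cmod_cis_sub_1 a : Cmod (Cminus (cis a) (RtoC 1)) <= Rabs a.
Proof.
  unfold Cmod, cis; simpl; rewrite <- sqrt_Rsqr_abs; apply sqrt_le_1_alt; unfold Rsqr.
  assert (h := sin2_cos2 a); unfold Rsqr in h.
  replace ((cos a + - (1)) * ((cos a + - (1)) * 1) + (sin a + - 0) * ((sin a + - 0) * 1))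
    with ((sin a * sin a + cos a * cos a) + 1 - 2 * cos a) by ring.
  rewrite h; replace (1 + 1 - 2 * cos a) with (2 * (1 - cos a)) by ring.
  rewrite one_minus_cos.
  assert (h1 := Rabs_sin_le (a / 2)); apply Rsqr_le_abs_1 in h1; unfold Rsqr in h1; nra.
Qed.

Lemma Cmod_cis_sub a b : Cmod (Cminus (cis a) (cis b)) <= Rabs (a - b).
Proof.
  replace (Cminus (cis a) (cis b)) with (Cmult (cis b) (Cminus (cis (a - b)) (RtoC 1))).
  - rewrite Cmod_mult, Cmod_cis, Rmult_1_l; apply Cmod_cis_sub_1.
  - replace (cis a) with (Cmult (cis b) (cis (a - b))); [ring |].
    rewrite <- cis_plus; f_equal; ring.
Qed.

Lemma Cmod_cis_sub_2 a b : Cmod (Cminus (cis a) (cis b)) <= 2.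
Proof.
  eapply Rle_trans; [apply Cmod_triangle |]; rewrite Cmod_opp, !Cmod_cis; lra.
Qed.

Lemma Cmod_pair_le a b : Cmod (a, b) <= Rabs a + Rabs b.
Proof.
  replace (a, b) with (Cplus (RtoC a) (Cmult Ci (RtoC b))) by
    (apply injective_projections; simpl; ring).
  eapply Rle_trans; [apply Cmod_triangle |].
  rewrite Cmod_mult, Cmod_Ci, !Cmod_R; lra.
Qed.

(** The real part contributes a^2 directly, the imaginary part another a^2 through the mean value
    theorem for sin y - y, whose derivative is at most |y| in modulus. This is why [hs] records two
    bounds. *)
Lemma Cmod_cis_taylor a : Cmod (Cminus (Cminus (cis a) (RtoC 1)) (0, a)) <= 2 * (a * a).
Proof.
  assert (hs : forall b, Rabs (cos b - 1) <= Rabs b /\ Rabs (cos b - 1) <= b * b).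
  { intros b; rewrite Rabs_minus_sym, one_minus_cos.
    assert (h1 := Rabs_sin_le (b / 2)).
    assert (h2 : Rabs (sin (b / 2)) <= 1) by (apply Rabs_le, SIN_bound).
    rewrite !Rabs_mult, (Rabs_right 2) by lra.
    unfold Rdiv in h1; rewrite (Rabs_mult b), (Rabs_right (/ 2)) in h1 by lra.
    fold (b / 2) in h1.
    assert (h3 := Rabs_pos (sin (b / 2))); assert (h4 := Rabs_pos b).
    rewrite <- (Rabs_pos_eq (b * b)) by apply Rle_0_sqr; rewrite Rabs_mult.
    split; nra. }
  eapply Rle_trans; [apply Cmod_pair_le |]; simpl.
  replace (cos a + - (1) + - 0) with (cos a - 1) by ring.
  replace (sin a + - 0 + - a) with (sin a - a) by ring.
  destruct (hs a) as [_ ha].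
  destruct (MVT_gen (fun y => sin y - y) 0 a (fun y => cos y - 1)) as [c [hc h]].
  - intros y _; auto_derive; [easy | ring].
  - intros y _; reg.
  - rewrite sin_0, !Rminus_0_r in h; rewrite h, Rabs_mult.
    destruct (hs c) as [hc' _].
    assert (hca : Rabs c <= Rabs a).
    { unfold Rmin, Rmax in hc; destruct (Rle_dec 0 a);
        unfold Rabs; repeat destruct Rcase_abs; lra. }
    replace (2 * (a * a)) with (a * a + Rabs a * Rabs a)
      by (rewrite <- Rabs_mult, Rabs_pos_eq by apply Rle_0_sqr; ring).
    assert (h5 := Rabs_pos a); assert (h6 := Rabs_pos (cos c - 1)); nra.
Qed.

Lemma sum_n_succ (a : nat -> R) m : sum_n a (S m) = sum_n a m + a (S m).
Proof. exact (sum_Sn a m). Qed.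

(** * The space c_0 *)

Definition tends_to_0 (x : nat -> C) : Prop :=
  forall e : posreal, exists N, forall n, (N <= n)%nat -> Cmod (x n) < e.

Lemma tends_to_0_dominated (x y : nat -> C) (M : R) :
  (forall n, Cmod (y n) <= M * Cmod (x n)) -> tends_to_0 x -> tends_to_0 y.
Proof.
  intros h hx e.
  assert (hM : 0 < Rabs M + 1) by (assert (h0 := Rabs_pos M); lra).
  assert (he : 0 < e / (Rabs M + 1)) by (apply Rdiv_lt_0_compat; [apply cond_pos | exact hM]).
  destruct (hx (mkposreal _ he)) as [N hN]; exists N; intros n hn.
  assert (h1 := hN n hn); simpl in h1.
  apply (Rmult_lt_compat_r (Rabs M + 1)) in h1; [| exact hM].
  unfold Rdiv in h1; rewrite Rmult_assoc, Rinv_l, Rmult_1_r in h1 by lra.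
  assert (h2 := h n); assert (h3 := Rle_abs M); assert (h4 := Cmod_ge_0 (x n)); nra.
Qed.

Lemma tends_to_0_plus (x y : nat -> C) :
  tends_to_0 x -> tends_to_0 y -> tends_to_0 (fun n => Cplus (x n) (y n)).
Proof.
  intros hx hy e.
  assert (he : 0 < e / 2) by (assert (h := cond_pos e); lra).
  destruct (hx (mkposreal _ he)) as [N hN]; destruct (hy (mkposreal _ he)) as [N' hN'].
  exists (N + N')%nat; intros n hn; simpl in *.
  eapply Rle_lt_trans; [apply Cmod_triangle |].
  assert (h1 := hN n ltac:(lia)); assert (h2 := hN' n ltac:(lia)); lra.
Qed.

(** With the moduli of single coordinates as seminorms, the resulting norm is the supremum norm. *)
Definition c0 : family_space nat.
Proof.
  apply (Build_family_space nat tends_to_0 (fun m x => Cmod (x m))).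
  - intros e; exists 0%nat; intros n _; rewrite Cmod_0; apply cond_pos.
  - exact tends_to_0_plus.
  - intros c x; apply (tends_to_0_dominated _ _ (Cmod c)).
    intros n; rewrite Cmod_mult; apply Rle_refl.
  - intros m x; apply Cmod_ge_0.
  - intros m x y; apply Cmod_triangle.
  - intros m c x; rewrite Cmod_mult; apply Rle_refl.
  - intros i; exists i; intros x; apply Rle_refl.
  - intros m F _ h e; apply h.
  - intros x hx; destruct (hx (mkposreal 1 Rlt_0_1)) as [N hN]; simpl in hN.
    assert (hb : exists M, forall m, (m < N)%nat -> Cmod (x m) <= M).
    { clear hN; induction N as [| N [M hM]]; [exists 0; lia |].
      exists (Rmax M (Cmod (x N))); intros m hm.
      destruct (PeanoNat.Nat.eq_dec m N) as [-> | hne]; [apply Rmax_r |].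
      eapply Rle_trans; [apply hM; lia | apply Rmax_l]. }
    destruct hb as [M hM]; exists (Rmax M 1); intros m.
    destruct (Compare_dec.le_lt_dec N m) as [h | h].
    + eapply Rle_trans; [apply Rlt_le, hN, h | apply Rmax_r].
    + eapply Rle_trans; [apply hM, h | apply Rmax_l].
  - intros x hx e.
    assert (he : 0 < e / 2) by (assert (h := cond_pos e); lra).
    destruct (hx (mkposreal _ he)) as [y [hy h]]; simpl in h.
    destruct (hy (mkposreal _ he)) as [N hN]; simpl in hN.
    exists N; intros n hn.
    replace (x n) with (Cplus (Cminus (x n) (y n)) (y n)) by ring.
    eapply Rle_lt_trans; [apply Cmod_triangle |].
    assert (h1 := h n); assert (h2 := hN n hn); lra.
Defined.

Definition c0_banach : CompleteNormedModule C_AbsRing := family_CompleteNormedModule c0.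

Lemma c0_norm_le (x : c0_banach) M : (forall n, Cmod (coord c0 x n) <= M) -> norm x <= M.
Proof. exact (norm_le_of_semi c0 x M). Qed.

Lemma c0_coord_le (x : c0_banach) n : Cmod (coord c0 x n) <= norm x.
Proof. exact (coord_le_norm c0 x n). Qed.

Lemma c0_coord_minus (x y : c0_banach) n :
  coord c0 (minus x y : c0_banach) n = Cminus (coord c0 x n) (coord c0 y n).
Proof. C_ring. Qed.

(** Dominated convergence in c_0: the majorant [y] makes all coordinates from some [N] on uniformly
    small, and the finitely many others converge one by one. *)
Lemma c0_filterlim {U : Type} (F : (U -> Prop) -> Prop) (f : U -> c0_banach) (l : c0_banach)
    (y : nat -> C) : Filter F -> tends_to_0 y ->
  F (fun u => forall n, Cmod (Cminus (coord c0 (f u) n) (coord c0 l n)) <= Cmod (y n)) ->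
  (forall n (e : posreal), F (fun u => Cmod (Cminus (coord c0 (f u) n) (coord c0 l n)) < e)) ->
  filterlim f F (locally l).
Proof.
  intros FF hy hd hp.
  apply filterlim_locally; intros e.
  assert (he : 0 < e / 2) by (assert (h := cond_pos e); lra).
  destruct (hy (mkposreal _ he)) as [N hN]; simpl in hN.
  assert (hf : F (fun u => forall n, (n < N)%nat ->
     Cmod (Cminus (coord c0 (f u) n) (coord c0 l n)) < e / 2)).
  { clear hN; induction N as [| N IH].
    - apply filter_forall; intros; lia.
    - generalize (filter_and _ _ IH (hp N (mkposreal _ he))); apply filter_imp.
      intros u [h1 h2] n hn; destruct (PeanoNat.Nat.eq_dec n N) as [-> | hne];
        [exact h2 | apply h1; lia]. }
  generalize (filter_and _ _ hf hd); apply filter_imp; intros u [h1 h2].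
  apply (norm_compat1 (V := c0_banach)).
  apply Rle_lt_trans with (e / 2); [| lra].
  apply c0_norm_le; intros n.
  rewrite c0_coord_minus.
  destruct (Compare_dec.le_lt_dec N n) as [h | h].
  - eapply Rle_trans; [apply h2 | apply Rlt_le, hN, h].
  - apply Rlt_le, h1, h.
Qed.

(** * The counterexample in c_0 *)

(* At [n = 0] this is [0], since [/ 0 = 0]. *)
Definition inv_nat (n : nat) : R := / INR n.

(* [A(t) = S^-1 A_0 S] with [A_0 = diag(i n)] and [S x = x + x_0 a(t)],
   [a(t) = (- i n^-2 e^(int))_n]. *)
Definition a_c0 (t : R) (n : nat) : C :=
  Cmult (0, - (inv_nat n * inv_nat n)) (cis (INR n * t)).

Definition S_c0 (t : R) (x : nat -> C) (n : nat) : C :=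
  Cplus (x n) (Cmult (a_c0 t n) (x 0%nat)).

(** The factor S^-1 is invisible here: it alters a sequence only by a multiple of its coordinate 0,
    and that coordinate of A_0 S x is 0. *)
Definition A_c0 (t : R) (x : c0_banach) : c0_banach :=
  make c0 (fun n => Cmult (0, INR n) (S_c0 t (coord c0 x) n)).

Definition D_c0 (x : c0_banach) : Prop :=
  member c0 (fun n => Cmult (0, INR n) (coord c0 x n)).

(** This is S^-1 e^(s A_0) S. Coordinate 0 has frequency 0, so it is fixed throughout and S^-1
    subtracts the same x_0 a(t) = S x - x that S added. *)
Definition G_c0 (t s : R) (x : c0_banach) : c0_banach :=
  make c0 (fun n => Cplus (coord c0 x n)
    (Cmult (Cminus (cis (INR n * s)) (RtoC 1)) (S_c0 t (coord c0 x) n))).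

Lemma inv_nat_mult n : INR n * (inv_nat n * inv_nat n) = inv_nat n.
Proof.
  unfold inv_nat; destruct n as [| n]; [simpl; rewrite Rinv_0; ring |].
  field; apply not_0_INR; lia.
Qed.

Lemma inv_nat_mult_le n : 0 <= INR n * inv_nat n <= 1.
Proof.
  unfold inv_nat; destruct n as [| n]; [simpl; lra |].
  rewrite Rinv_r by (apply not_0_INR; lia); lra.
Qed.

Lemma inv_nat_bounds n : 0 <= inv_nat n <= 1.
Proof.
  unfold inv_nat; destruct n as [| n]; [simpl; rewrite Rinv_0; lra |].
  assert (h : 1 <= INR (S n)) by (rewrite S_INR; assert (h := pos_INR n); lra).
  split; [apply Rlt_le, Rinv_0_lt_compat; lra |].
  rewrite <- Rinv_1; apply Rinv_le_contravar; lra.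
Qed.

Lemma Cmod_imag w : 0 <= w -> Cmod (0, w) = w.
Proof.
  intros hw; replace (0, w) with (Cmult Ci (RtoC w)) by (apply injective_projections; simpl; ring).
  rewrite Cmod_mult, Cmod_Ci, Cmod_R, Rabs_pos_eq by exact hw; ring.
Qed.

Lemma inv_nat_tends_to_0 : tends_to_0 (fun n => RtoC (inv_nat n)).
Proof.
  intros e; destruct (archimed_cor1 e (cond_pos e)) as [N [h hN]].
  exists N; intros n hn; rewrite Cmod_R, Rabs_pos_eq by apply inv_nat_bounds.
  eapply Rle_lt_trans; [| exact h]; unfold inv_nat.
  apply Rinv_le_contravar; [now apply lt_0_INR | now apply le_INR].
Qed.

Lemma imag_a_c0 t n : Cmult (0, INR n) (a_c0 t n) = Cmult (RtoC (inv_nat n)) (cis (INR n * t)).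
Proof.
  unfold a_c0; rewrite Cmult_assoc; f_equal.
  rewrite <- (inv_nat_mult n) at 3; apply injective_projections; simpl; ring.
Qed.

Lemma Cmod_a_c0 t n : Cmod (a_c0 t n) = inv_nat n * inv_nat n.
Proof.
  unfold a_c0; rewrite Cmod_mult, Cmod_cis, Rmult_1_r.
  replace (0, - (inv_nat n * inv_nat n)) with (Copp (0, inv_nat n * inv_nat n))
    by (apply injective_projections; simpl; ring).
  rewrite Cmod_opp; apply Cmod_imag; assert (h := inv_nat_bounds n); nra.
Qed.

Lemma S_c0_member t x : tends_to_0 x -> tends_to_0 (S_c0 t x).
Proof.
  intros hx; apply tends_to_0_plus; [exact hx |].
  apply (tends_to_0_dominated (fun n => RtoC (inv_nat n)) _ (Cmod (x 0%nat)));
    [| apply inv_nat_tends_to_0].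
  intros n; rewrite Cmod_mult, Cmod_a_c0, Cmod_R, Rabs_pos_eq by apply inv_nat_bounds.
  assert (h := inv_nat_bounds n); assert (h' := Cmod_ge_0 (x 0%nat)).
  assert (h2 : inv_nat n * inv_nat n <= inv_nat n) by nra; nra.
Qed.

Lemma imag_S_c0 t x n : Cmult (0, INR n) (S_c0 t x n) =
  Cplus (Cmult (0, INR n) (x n)) (Cmult (RtoC (inv_nat n)) (Cmult (cis (INR n * t)) (x 0%nat))).
Proof.
  unfold S_c0; rewrite Cmult_plus_distr_l, Cmult_assoc, imag_a_c0, !Cmult_assoc; reflexivity.
Qed.

Lemma coupling_member t (c : C) :
  tends_to_0 (fun n => Cmult (RtoC (inv_nat n)) (Cmult (cis (INR n * t)) c)).
Proof.
  apply (tends_to_0_dominated (fun n => RtoC (inv_nat n)) _ (Cmod c));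
    [| apply inv_nat_tends_to_0].
  intros n; rewrite !Cmod_mult, Cmod_cis; apply Req_le; ring.
Qed.

(** The domain does not depend on [t]: i n a_n(t) has modulus [inv_nat n], so applying S changes i n
    x_n by a sequence in c_0. *)
Lemma D_c0_iff t (x : c0_banach) :
  D_c0 x <-> member c0 (fun n => Cmult (0, INR n) (S_c0 t (coord c0 x) n)).
Proof.
  unfold D_c0; simpl; split; intros h.
  - apply (tends_to_0_dominated (fun n => Cplus (Cmult (0, INR n) (coord c0 x n))
      (Cmult (RtoC (inv_nat n)) (Cmult (cis (INR n * t)) (coord c0 x 0%nat)))) _ 1).
    + intros n; rewrite imag_S_c0; lra.
    + apply tends_to_0_plus; [exact h | apply coupling_member].
  - apply (tends_to_0_dominated (fun n => Cplus (Cmult (0, INR n) (S_c0 t (coord c0 x) n))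
      (Cmult (RtoC (inv_nat n)) (Cmult (cis (INR n * t)) (Copp (coord c0 x 0%nat))))) _ 1).
    + intros n; rewrite imag_S_c0.
      apply Req_le; rewrite Rmult_1_l; f_equal; ring.
    + apply tends_to_0_plus; [exact h | apply coupling_member].
Qed.

Lemma A_c0_coord t (x : c0_banach) : D_c0 x -> forall n,
  coord c0 (A_c0 t x) n = Cmult (0, INR n) (S_c0 t (coord c0 x) n).
Proof.
  intros h n; unfold A_c0; rewrite coord_make; [reflexivity | now apply D_c0_iff].
Qed.

Lemma G_c0_coord t s (x : c0_banach) n : coord c0 (G_c0 t s x) n =
  Cplus (coord c0 x n) (Cmult (Cminus (cis (INR n * s)) (RtoC 1)) (S_c0 t (coord c0 x) n)).
Proof.
  unfold G_c0; rewrite coord_make; [reflexivity |].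
  apply member_plus; [apply (proj2_sig x) |].
  apply (tends_to_0_dominated (S_c0 t (coord c0 x)) _ 2); [| apply S_c0_member, (proj2_sig x)].
  intros n'; rewrite Cmod_mult; apply Rmult_le_compat_r; [apply Cmod_ge_0 |].
  rewrite <- cis_0; apply Cmod_cis_sub_2.
Qed.

Lemma D_c0_subspace : subspace D_c0.
Proof.
  unfold D_c0; simpl; repeat split.
  - apply (tends_to_0_dominated (fun n => RtoC (inv_nat n)) _ 0); [| apply inv_nat_tends_to_0].
    intros n; rewrite Rmult_0_l, Cmult_0_r, Cmod_0; apply Rle_refl.
  - intros x y hx hy.
    refine (tends_to_0_dominated _ _ 1 _ (tends_to_0_plus _ _ hx hy)).
    intros n; apply Req_le; rewrite Rmult_1_l; f_equal; C_ring.
  - intros c x hx.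
    refine (tends_to_0_dominated _ _ (Cmod c) _ hx).
    intros n; apply Req_le; rewrite <- Cmod_mult; f_equal; C_ring.
Qed.

Lemma A_c0_linear t : linear_on D_c0 (A_c0 t).
Proof.
  destruct D_c0_subspace as [_ [hp hs]]; split.
  - intros x y hx hy; apply coord_inj; intros n.
    transitivity (Cplus (coord c0 (A_c0 t x) n) (coord c0 (A_c0 t y) n)); [| C_ring].
    rewrite !A_c0_coord by auto; unfold S_c0; C_ring.
  - intros c x hx; apply coord_inj; intros n.
    transitivity (Cmult c (coord c0 (A_c0 t x) n)); [| C_ring].
    rewrite !A_c0_coord by auto; unfold S_c0; C_ring.
Qed.

(** The factor n in |e^(int) - e^(ins)| <= n |t - s| is cancelled exactly by the coupling strength
    1/n. *)
Lemma A_c0_lipschitz t s (y : c0_banach) : D_c0 y ->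
  norm (minus (A_c0 t y) (A_c0 s y)) <= Rabs (t - s) * norm y.
Proof.
  intros hy; apply c0_norm_le; intros n.
  rewrite c0_coord_minus, !A_c0_coord, !imag_S_c0 by exact hy.
  match goal with |- Cmod ?z <= _ => replace z with
    (Cmult (Cmult (RtoC (inv_nat n)) (Cminus (cis (INR n * t)) (cis (INR n * s))))
       (coord c0 y 0%nat)) by ring end.
  rewrite !Cmod_mult, Cmod_R, Rabs_pos_eq by apply inv_nat_bounds.
  apply Rmult_le_compat; [| apply Cmod_ge_0 | | apply c0_coord_le].
  { apply Rmult_le_pos; [apply inv_nat_bounds | apply Cmod_ge_0]. }
  assert (h1 := Cmod_cis_sub (INR n * t) (INR n * s)).
  rewrite <- Rmult_minus_distr_l, Rabs_mult, Rabs_pos_eq in h1 by apply pos_INR.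
  assert (h2 := inv_nat_mult_le n); assert (h3 := inv_nat_bounds n).
  assert (h4 := Rabs_pos (t - s)); assert (h5 := pos_INR n).
  apply Rle_trans with (inv_nat n * (INR n * Rabs (t - s))); [| nra].
  apply Rmult_le_compat_l; lra.
Qed.

(** S intertwines the group with the diagonal one; the group law follows from this. *)
Lemma S_c0_G t s (x : c0_banach) n :
  S_c0 t (coord c0 (G_c0 t s x)) n = Cmult (cis (INR n * s)) (S_c0 t (coord c0 x) n).
Proof.
  unfold S_c0 at 1; rewrite !G_c0_coord; simpl INR.
  rewrite Rmult_0_l, cis_0; unfold S_c0; ring.
Qed.

(** Coordinate n is e^(ins) x_n, of modulus |x_n|, plus (e^(ins) - 1) a_n(t) x_0, of modulus at most
    n |s| n^-2 |x_0|. As 1 + |s| <= e^|s|, this gives the growth bound with omega = 1 and no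
    multiplicative constant. *)
Lemma G_c0_norm t s (x : c0_banach) : norm (G_c0 t s x) <= (1 + Rabs s) * norm x.
Proof.
  apply c0_norm_le; intros n; rewrite G_c0_coord.
  replace (Cplus (coord c0 x n)
    (Cmult (Cminus (cis (INR n * s)) (RtoC 1)) (S_c0 t (coord c0 x) n))) with
    (Cplus (Cmult (cis (INR n * s)) (coord c0 x n))
      (Cmult (Cmult (Cminus (cis (INR n * s)) (RtoC 1)) (a_c0 t n)) (coord c0 x 0%nat)))
    by (unfold S_c0; ring).
  eapply Rle_trans; [apply Cmod_triangle |].
  rewrite !Cmod_mult, Cmod_cis, Cmod_a_c0.
  assert (h1 := Cmod_cis_sub_1 (INR n * s)); rewrite Rabs_mult, (Rabs_pos_eq (INR n)) in h1
    by apply pos_INR.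
  assert (h2 := inv_nat_mult n); assert (h3 := inv_nat_bounds n).
  assert (h4 := c0_coord_le x n); assert (h5 := c0_coord_le x 0).
  assert (h6 := Rabs_pos s); assert (h7 := Cmod_ge_0 (coord c0 x 0%nat)).
  assert (h8 := Cmod_ge_0 (Cminus (cis (INR n * s)) (RtoC 1))).
  set (m := Cmod (Cminus (cis (INR n * s)) (RtoC 1))) in *.
  assert (h9 : m * (inv_nat n * inv_nat n) <= Rabs s).
  { apply Rle_trans with (INR n * Rabs s * (inv_nat n * inv_nat n)).
    - apply Rmult_le_compat_r; [nra | exact h1].
    - replace (INR n * Rabs s * (inv_nat n * inv_nat n)) with
        (Rabs s * (INR n * (inv_nat n * inv_nat n))) by ring.
      rewrite h2; nra. }
  assert (h10 : m * (inv_nat n * inv_nat n) * Cmod (coord c0 x 0%nat) <= Rabs s * norm x).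
  { apply Rmult_le_compat; try assumption; apply Rmult_le_pos; [exact h8 | nra]. }
  lra.
Qed.

(** * Strong continuity and the generator of the explicit group *)

Lemma cis_locally (w s : R) (e : posreal) :
  locally s (fun r => Cmod (Cminus (cis (w * r)) (cis (w * s))) < e).
Proof.
  assert (hw : 0 < Rabs w + 1) by (assert (h := Rabs_pos w); lra).
  assert (hd : 0 < e / (Rabs w + 1)) by (apply Rdiv_lt_0_compat; [apply cond_pos | exact hw]).
  exists (mkposreal _ hd); intros r hr.
  assert (hr' : Rabs (r - s) < e / (Rabs w + 1)) by exact hr.
  eapply Rle_lt_trans; [apply Cmod_cis_sub |].
  rewrite <- Rmult_minus_distr_l, Rabs_mult.
  apply (Rmult_lt_compat_r (Rabs w + 1)) in hr'; [| exact hw].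
  unfold Rdiv in hr'; rewrite Rmult_assoc, Rinv_l, Rmult_1_r in hr' by lra.
  assert (h := Rabs_pos (r - s)); nra.
Qed.

Lemma Cmod_small_mult (F : (R -> Prop) -> Prop) (f : R -> C) (c : C) : Filter F ->
  (forall e : posreal, F (fun r => Cmod (f r) < e)) ->
  forall e : posreal, F (fun r => Cmod (Cmult (f r) c) < e).
Proof.
  intros FF h e.
  assert (hc : 0 < Cmod c + 1) by (assert (h0 := Cmod_ge_0 c); lra).
  assert (hd : 0 < e / (Cmod c + 1)) by (apply Rdiv_lt_0_compat; [apply cond_pos | exact hc]).
  generalize (h (mkposreal _ hd)); apply filter_imp; intros r hr; simpl in hr.
  rewrite Cmod_mult.
  apply (Rmult_lt_compat_r (Cmod c + 1)) in hr; [| exact hc].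
  unfold Rdiv in hr; rewrite Rmult_assoc, Rinv_l, Rmult_1_r in hr by lra.
  assert (h0 := Cmod_ge_0 (f r)); nra.
Qed.

Lemma G_c0_group t : strongly_continuous_group (G_c0 t).
Proof.
  split.
  - intros s; split.
    + intros x y; apply coord_inj; intros n.
      transitivity (Cplus (coord c0 (G_c0 t s x) n) (coord c0 (G_c0 t s y) n)); [| C_ring].
      rewrite !G_c0_coord; unfold S_c0; C_ring.
    + intros c x; apply coord_inj; intros n.
      transitivity (Cmult c (coord c0 (G_c0 t s x) n)); [| C_ring].
      rewrite !G_c0_coord; unfold S_c0; C_ring.
    + exists (1 + Rabs s); split; [assert (h := Rabs_pos s); lra | apply G_c0_norm].
  - intros x; apply coord_inj; intros n; rewrite G_c0_coord, Rmult_0_r, cis_0; ring.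
  - intros r s x; apply coord_inj; intros n.
    rewrite (G_c0_coord t r), S_c0_G, !G_c0_coord, Rmult_plus_distr_l, cis_plus; ring.
  - intros x s.
    assert (hd : forall r n, Cminus (coord c0 (G_c0 t r x) n) (coord c0 (G_c0 t s x) n) =
      Cmult (Cminus (cis (INR n * r)) (cis (INR n * s))) (S_c0 t (coord c0 x) n)).
    { intros r n; rewrite !G_c0_coord; ring. }
    apply (c0_filterlim _ _ _ (fun n => Cmult (RtoC 2) (S_c0 t (coord c0 x) n))).
    + apply filter_filter.
    + apply (member_scal _ c0), S_c0_member, (proj2_sig x).
    + apply filter_forall; intros r n; rewrite hd, !Cmod_mult, Cmod_R, Rabs_pos_eq by lra.
      apply Rmult_le_compat_r; [apply Cmod_ge_0 | apply Cmod_cis_sub_2].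
    + intros n e.
      generalize (Cmod_small_mult _ _ (S_c0 t (coord c0 x) n) _ (cis_locally (INR n) s) e).
      apply filter_imp; intros r hr; rewrite hd; exact hr.
Qed.

Definition cis_quotient (w h : R) : C := Cmult (RtoC (/ h)) (Cminus (cis (w * h)) (RtoC 1)).

(** The limit of the quotient is not uniform in [w], but this bound is uniform in [h]; it supplies
    the majorant of [c0_filterlim] for the difference quotients. *)
Lemma Cmod_cis_quotient_le w h : 0 <= w -> h <> 0 -> Cmod (cis_quotient w h) <= w.
Proof.
  intros hw hh; unfold cis_quotient; rewrite Cmod_mult, Cmod_R, Rabs_inv.
  assert (h1 := Cmod_cis_sub_1 (w * h)); rewrite Rabs_mult, (Rabs_pos_eq w hw) in h1.
  assert (h2 : 0 < Rabs h) by now apply Rabs_pos_lt.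
  apply Rmult_le_reg_l with (Rabs h); [exact h2 |].
  rewrite <- Rmult_assoc, Rinv_r by lra; lra.
Qed.

Lemma cis_quotient_lim w (e : posreal) :
  locally' 0 (fun h => Cmod (Cminus (cis_quotient w h) (0, w)) < e).
Proof.
  assert (hw : 0 < 2 * (w * w) + 1) by (assert (h := Rle_0_sqr w); unfold Rsqr in h; lra).
  assert (hd : 0 < e / (2 * (w * w) + 1)) by (apply Rdiv_lt_0_compat; [apply cond_pos | exact hw]).
  exists (mkposreal _ hd); intros h hh hne.
  assert (h1 : Rabs (h - 0) < e / (2 * (w * w) + 1)) by exact hh.
  rewrite Rminus_0_r in h1.
  replace (Cminus (cis_quotient w h) (0, w)) with
    (Cmult (RtoC (/ h)) (Cminus (Cminus (cis (w * h)) (RtoC 1)) (0, w * h))).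
  2: { unfold cis_quotient; apply injective_projections; simpl; field; exact hne. }
  rewrite Cmod_mult, Cmod_R, Rabs_inv.
  assert (h2 := Cmod_cis_taylor (w * h)).
  assert (h3 : 0 < Rabs h) by now apply Rabs_pos_lt.
  assert (h4 : w * h * (w * h) = w * w * (Rabs h * Rabs h)).
  { rewrite <- Rabs_mult, Rabs_pos_eq by apply Rle_0_sqr; ring. }
  rewrite h4 in h2.
  apply (Rmult_lt_compat_r (2 * (w * w) + 1)) in h1; [| exact hw].
  unfold Rdiv in h1; rewrite Rmult_assoc, Rinv_l, Rmult_1_r in h1 by lra.
  apply Rmult_lt_reg_l with (Rabs h); [exact h3 |].
  rewrite <- Rmult_assoc, Rinv_r, Rmult_1_l by lra.
  assert (h5 := Rle_0_sqr w); unfold Rsqr in h5; nra.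
Qed.

Lemma G_c0_quotient t h (x : c0_banach) n :
  coord c0 (scal (RtoC (/ h)) (minus (G_c0 t h x) x)) n =
  Cmult (cis_quotient (INR n) h) (S_c0 t (coord c0 x) n).
Proof.
  transitivity (Cmult (RtoC (/ h)) (Cminus (coord c0 (G_c0 t h x) n) (coord c0 x n))); [C_ring |].
  rewrite G_c0_coord; unfold cis_quotient; ring.
Qed.

(** On the domain the quotients converge by domination with 2 n |(S x)_n|. Conversely, a limit [z]
    in norm is also a limit in each coordinate, which forces z_n = i n (S x)_n; since [z] lies in
    c_0, [x] lies in the domain. *)
Lemma G_c0_generator t : is_generator D_c0 (A_c0 t) (G_c0 t).
Proof.
  assert (hlim : forall x n (e : posreal), locally' 0 (fun h =>
    Cmod (Cminus (coord c0 (scal (RtoC (/ h)) (minus (G_c0 t h x) x)) n)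
            (Cmult (0, INR n) (S_c0 t (coord c0 x) n))) < e)).
  { intros x n e.
    generalize (Cmod_small_mult _ _ (S_c0 t (coord c0 x) n) _ (cis_quotient_lim (INR n)) e).
    apply filter_imp; intros h hh; rewrite G_c0_quotient.
    eapply Rle_lt_trans; [| exact hh]; apply Req_le; f_equal; ring. }
  intros x z; split.
  - intros [hx <-].
    apply (c0_filterlim _ _ _
      (fun n => Cmult (RtoC 2) (Cmult (0, INR n) (S_c0 t (coord c0 x) n)))).
    + apply locally'_filter.
    + apply (member_scal _ c0), D_c0_iff, hx.
    + exists (mkposreal 1 Rlt_0_1); intros h _ hne n.
      rewrite A_c0_coord, G_c0_quotient by exact hx.
      replace (Cminus (Cmult (cis_quotient (INR n) h) (S_c0 t (coord c0 x) n))
         (Cmult (0, INR n) (S_c0 t (coord c0 x) n))) with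
        (Cmult (Cminus (cis_quotient (INR n) h) (0, INR n)) (S_c0 t (coord c0 x) n)) by ring.
      rewrite !Cmod_mult, Cmod_R, Rabs_pos_eq, Cmod_imag by (lra || apply pos_INR).
      rewrite <- Rmult_assoc; apply Rmult_le_compat_r; [apply Cmod_ge_0 |].
      eapply Rle_trans; [apply Cmod_triangle |].
      rewrite Cmod_opp, Cmod_imag by apply pos_INR.
      assert (h1 := Cmod_cis_quotient_le (INR n) h (pos_INR n) hne); lra.
    + intros n e; rewrite A_c0_coord by exact hx; apply hlim.
  - intros hz.
    assert (hc : forall n, coord c0 z n = Cmult (0, INR n) (S_c0 t (coord c0 x) n)).
    { intros n; set (c := Cmult (0, INR n) (S_c0 t (coord c0 x) n)).
      enough (h : Cminus (coord c0 z n) c = RtoC 0).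
      { replace (coord c0 z n) with (Cplus (Cminus (coord c0 z n) c) c) by ring.
        rewrite h; ring. }
      apply Cmod_eq_0, Rle_antisym; [| apply Cmod_ge_0]; unfold c.
      apply le_epsilon; intros e he; rewrite Rplus_0_l.
      assert (he2 : 0 < e / 2) by lra.
      assert (h1 : locally z (fun y => norm (minus y z) < e / 2)).
      { apply (locally_le_locally_norm (V := c0_banach) z).
        exists (mkposreal _ he2); intros y hy; exact hy. }
      assert (h2 : locally' 0 (fun h : R =>
        norm (minus (scal (RtoC (/ h)) (minus (G_c0 t h x) x)) z) < e / 2)) by exact (hz _ h1).
      destruct (@filter_ex _ _ (Rbar_locally'_filter 0) _
        (@filter_and _ _ (locally'_filter 0) _ _ h2 (hlim x n (mkposreal _ he2)))) as [h [h5 h3]].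
      simpl in h3.
      set (q := scal (RtoC (/ h)) (minus (G_c0 t h x) x)) in *.
      assert (h4 := c0_coord_le (minus q z) n).
      rewrite c0_coord_minus, <- Cmod_opp, Copp_minus_distr in h4.
      replace (Cminus (coord c0 z n) (Cmult (0, INR n) (S_c0 t (coord c0 x) n))) with
        (Cplus (Cminus (coord c0 z n) (coord c0 q n))
           (Cminus (coord c0 q n) (Cmult (0, INR n) (S_c0 t (coord c0 x) n)))) by ring.
      eapply Rle_trans; [apply Cmod_triangle |].
      apply Rlt_le; eapply Rlt_le_trans; [apply Rplus_le_lt_compat; [apply h4 | apply h3] |].
      apply Rle_trans with (e / 2 + e / 2); [| lra].
      apply Rplus_le_compat_r, Rlt_le, h5. }
    assert (hD : D_c0 x).
    { apply (D_c0_iff t).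
      rewrite <- (functional_extensionality (coord c0 z) _ hc); apply (proj2_sig z). }
    split; [exact hD |].
    apply coord_inj; intros n; rewrite hc; now apply A_c0_coord.
Qed.

Lemma A_c0_generates t : generates_group_bounded_by D_c0 (A_c0 t) 1.
Proof.
  exists (G_c0 t); split; [apply G_c0_group | split; [apply G_c0_generator |]].
  intros s; apply operator_norm_le; [apply Rlt_le, exp_pos |].
  intros y _ hy; eapply Rle_trans; [apply G_c0_norm |].
  assert (h := exp_ineq1_le (Rabs s)); assert (h' := Rabs_pos s); rewrite Rmult_1_l.
  assert (h0 := norm_ge_0 y).
  apply Rle_trans with ((1 + Rabs s) * 1); [apply Rmult_le_compat_l; lra | lra].
Qed.

(** * Regularity of the family in c_0, and the escaping trajectory *)

Lemma A_c0_in_LYX : family_in_LYX 1 D_c0 A_c0.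
Proof.
  apply (perturbation_in_LYX D_c0 1 A_c0 (fun t s => Rabs (t - s))).
  - intros; apply Rabs_pos.
  - intros t s _ _ y; apply A_c0_lipschitz.
  - lra.
  - intros t _; apply A_c0_linear.
Qed.

Lemma dist_A_c0 t s : in_I 1 t -> in_I 1 s -> dist_YX D_c0 A_c0 t s <= Rabs (t - s).
Proof.
  apply (dist_YX_le D_c0 1 A_c0 (fun t s => Rabs (t - s))).
  - intros; apply Rabs_pos.
  - intros r r' _ _ y; apply A_c0_lipschitz.
Qed.

Lemma A_c0_continuous : continuous_LYX 1 D_c0 A_c0.
Proof.
  split; [apply A_c0_in_LYX |].
  intros t ht; apply filterlim_locally; intros e.
  exists e; intros s hs hI.
  assert (hs' : Rabs (s - t) < e) by exact hs.
  change (Rabs (dist_YX D_c0 A_c0 s t - 0) < e).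
  rewrite Rminus_0_r, Rabs_pos_eq by apply operator_norm_ge_0.
  eapply Rle_lt_trans; [apply dist_A_c0; assumption | exact hs'].
Qed.

Lemma A_c0_bounded_variation : bounded_variation_LYX 1 D_c0 A_c0.
Proof.
  split; [apply A_c0_in_LYX |].
  exists 1; intros n p hI hmono.
  (* By the Lipschitz bound the sum telescopes along the increasing points. *)
  apply Rle_trans with (p (S n) - p 0%nat).
  - assert (h : forall m, (m <= n)%nat ->
      sum_n (fun k => dist_YX D_c0 A_c0 (p (S k)) (p k)) m <= p (S m) - p 0%nat).
    { assert (hs : forall k, (k <= n)%nat ->
        dist_YX D_c0 A_c0 (p (S k)) (p k) <= p (S k) - p k).
      { intros k hk; eapply Rle_trans; [apply dist_A_c0; apply hI; lia |].
        apply Req_le, Rabs_pos_eq; assert (h := hmono k hk); lra. }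
      intros m; induction m as [| m IH]; intros hm.
      - rewrite sum_O; apply hs; lia.
      - rewrite sum_n_succ.
        assert (h1 := IH ltac:(lia)); assert (h2 := hs (S m) hm); lra. }
    apply h; lia.
  - assert (h1 := hI 0%nat ltac:(lia)); assert (h2 := hI (S n) ltac:(lia)).
    unfold in_I in *; lra.
Qed.

Lemma A_c0_no_evolution_system U : ~ evolution_system 1 D_c0 A_c0 U.
Proof.
  intros hU.
  set (y0 := fun n : nat => match n with O => RtoC 1 | S _ => RtoC 0 end).
  assert (hfin : forall c : nat -> C, tends_to_0 (fun n => Cmult (c n) (y0 n))).
  { intros c e; exists 1%nat; intros [| n] hn; [lia |]; simpl.
    rewrite Cmult_0_r, Cmod_0; apply cond_pos. }
  assert (hy0 : tends_to_0 y0).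
  { apply (tends_to_0_dominated (fun n => Cmult (RtoC 1) (y0 n)) _ 1); [| apply hfin].
    intros n; rewrite Cmult_1_l; lra. }
  set (y := make c0 y0 : c0_banach).
  assert (hy : coord c0 y = y0) by now apply coord_make.
  assert (hyD : D_c0 y) by (unfold D_c0; rewrite hy; apply hfin).
  assert (h0 : in_I 1 0) by (unfold in_I; lra).
  assert (h1 : in_I 1 1) by (unfold in_I; lra).
  set (x := fun r => U r 0 y).
  assert (hxD : forall t, in_I 1 t -> D_c0 (x t)) by (intros t ht; now apply (es_domain _ _ _ _ _ hU)).
  assert (hx : forall t, in_I 1 t -> is_derive_on 1 x t (A_c0 t (x t))).
  { intros t ht; now apply (es_derive _ _ _ _ _ hU). }
  assert (hxc : forall n t, in_I 1 t -> coord c0 (A_c0 t (x t)) n =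
    Cplus (Cmult (RtoC (inv_nat n)) (Cmult (cis (INR n * t)) (coord c0 (x t) 0%nat)))
          (Cmult (0, INR n) (coord c0 (x t) n))).
  { intros n t ht; rewrite A_c0_coord, imag_S_c0 by auto; ring. }
  assert (hx0 : x 0 = y) by now apply (es_id _ _ _ _ _ hU).
  set (u := fun r : R => Re (coord c0 (x (clamp 1 r)) 0%nat)).
  (* At index 0 both the frequency and [inv_nat 0] vanish, so x_0 keeps its initial value 1. *)
  assert (hu : forall t, 0 < t < 1 -> is_derive u t 0).
  { intros t ht; assert (hI : in_I 1 t) by (unfold in_I; lra).
    assert (h := functional_is_derive _ 1 x (Re_functional c0 0%nat) t _ ht (hx t hI)).
    cbv beta in h; rewrite hxc in h by exact hI.
    replace (Re _) with 0 in h; [exact h |].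
    unfold inv_nat; simpl; rewrite Rinv_0; ring. }
  assert (hucont : forall t, continuity_pt u t).
  { apply (functional_continuity _ 1 x (Re_functional c0 0%nat)); [lra |]; eauto. }
  assert (hgrow : forall n, n <> 0%nat -> inv_nat n <= Cmod (coord c0 (x 1) n)).
  { intros n hn.
    (* As [u] is constant, the rotated coordinate grows linearly with slope [inv_nat n * u]; [g]
       subtracts this growth and has derivative 0. *)
    set (g := fun t => rotating c0 1 (INR n) n x t - inv_nat n * t * u t).
    assert (hg : g 1 = g 0).
    { apply eq_of_is_derive_0; [lra | |].
      - intros t; apply (continuity_pt_minus _ (fun t => _ * _)).
        + apply (rotating_continuity c0 1 _ _ x (fun t => A_c0 t (x t))); [lra | exact hx].
        + apply (continuity_pt_mult (fun t => _) u); [reg | apply hucont].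
      - intros t ht.
        assert (hr := rotating_is_derive c0 1 (INR n) (inv_nat n) n 0%nat x _ hx (hxc n) t ht).
        change (Re (coord c0 (x (clamp 1 t)) 0%nat)) with (u t) in hr.
        unfold g; set (f := rotating c0 1 (INR n) n x) in *.
        assert (hu' := hu t ht).
        clearbody f u.
        auto_derive; [split; [eexists; exact hr | split; [eexists; exact hu' | easy]] |].
        replace (Derive (fun x => f x) t) with (Derive f t) by reflexivity.
        replace (Derive (fun x => u x) t) with (Derive u t) by reflexivity.
        rewrite (is_derive_unique _ _ _ hr), (is_derive_unique _ _ _ hu'); ring. }
    assert (hu1 : u 1 = u 0) by (apply eq_of_is_derive_0; [lra | exact hucont | exact hu]).
    assert (hu0 : u 0 = 1).
    { unfold u; rewrite clamp_id, hx0, hy by exact h0; reflexivity. }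
    unfold g in hg; rewrite hu1, hu0, rotating_0, hx0, hy in hg by lra.
    assert (hle := rotating_le_Cmod c0 1 (INR n) n x 1 h1).
    destruct n as [| n]; [easy |]; simpl Re in hg; lra. }
  (* Membership in the domain makes |n x_n(1)| < 1 for large n, against the lower bound 1. The index
     [S N] avoids n = 0. *)
  destruct (hxD 1 h1 (mkposreal 1 Rlt_0_1)) as [N hN]; simpl in hN.
  assert (h2 := hN (S N) ltac:(lia)).
  rewrite Cmod_mult, Cmod_imag in h2 by apply pos_INR.
  assert (h3 := hgrow (S N) ltac:(lia)).
  assert (h4 : 0 < INR (S N)) by (apply lt_0_INR; lia).
  apply (Rmult_le_compat_l (INR (S N))) in h3; [| lra].
  unfold inv_nat in h3; rewrite Rinv_r in h3 by lra.
  simpl INR in *; lra.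
Qed.

(** * The Hilbert space of square-summable sequences of pairs *)

Lemma Cmod_pair_sqr a b : Cmod (a, b) * Cmod (a, b) = a * a + b * b.
Proof.
  unfold Cmod; simpl; rewrite !Rmult_1_r; apply sqrt_sqrt.
  assert (h := Rle_0_sqr a); assert (h' := Rle_0_sqr b); unfold Rsqr in *; lra.
Qed.

Lemma Cmod_pair_mono a b a' b' : 0 <= a <= a' -> 0 <= b <= b' -> Cmod (a, b) <= Cmod (a', b').
Proof. intros ha hb; unfold Cmod; simpl; apply sqrt_le_1_alt; nra. Qed.

(** Minkowski's inequality in the plane, read off from the triangle inequality in [C]. Nesting
    moduli of pairs extends it to all the seminorms of l^2. *)
Lemma Cmod_pair_triangle p q a b c d : 0 <= p <= a + b -> 0 <= q <= c + d ->
  Cmod (p, q) <= Cmod (a, c) + Cmod (b, d).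
Proof.
  intros hp hq; eapply Rle_trans; [apply (Cmod_pair_mono _ _ (a + b) (c + d)); assumption |].
  apply (Cmod_triangle (a, c) (b, d)).
Qed.

Lemma Cmod_pair_scal c a b : 0 <= c -> Cmod (c * a, c * b) = c * Cmod (a, b).
Proof.
  intros hc; rewrite <- (Rabs_pos_eq c hc) at 3; rewrite <- Cmod_R, <- Cmod_mult.
  f_equal; apply injective_projections; simpl; ring.
Qed.

Lemma Cmod_pair_ge_l a b : 0 <= a -> a <= Cmod (a, b).
Proof.
  intros ha; rewrite <- (Rabs_pos_eq a ha) at 1.
  exact (re_le_Cmod (a, b)).
Qed.

Lemma Cmod_pair_ge_r a b : 0 <= b -> b <= Cmod (a, b).
Proof.
  intros hb; rewrite <- (Rabs_pos_eq b hb) at 1.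
  eapply Rle_trans; [| apply Rmax_Cmod]; apply Rmax_r.
Qed.

Lemma Cmod_pair_0 a : 0 <= a -> Cmod (a, 0) = a.
Proof.
  intros ha; change (Cmod (RtoC a) = a); rewrite Cmod_R; now apply Rabs_pos_eq.
Qed.

Definition pairs : Type := bool * nat.

Definition block (x : pairs -> C) (k : nat) : R := Cmod (Cmod (x (false, k)), Cmod (x (true, k))).

(** The Euclidean norm of the first [m + 1] blocks. *)
Fixpoint l2_semi (m : nat) (x : pairs -> C) : R :=
  match m with
  | O => block x 0
  | S m => Cmod (l2_semi m x, block x (S m))
  end.

Lemma block_ge_0 x k : 0 <= block x k.
Proof. apply Cmod_ge_0. Qed.

Lemma l2_semi_ge_0 m x : 0 <= l2_semi m x.
Proof. destruct m; apply Cmod_ge_0. Qed.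

Lemma Cmod_le_block x b k : Cmod (x (b, k)) <= block x k.
Proof.
  destruct b; [apply Cmod_pair_ge_r | apply Cmod_pair_ge_l]; apply Cmod_ge_0.
Qed.

Lemma block_le_l2_semi x m : block x m <= l2_semi m x.
Proof.
  destruct m; [apply Rle_refl | apply Cmod_pair_ge_r, block_ge_0].
Qed.

Lemma block_plus x y k :
  block (fun i => Cplus (x i) (y i)) k <= block x k + block y k.
Proof.
  apply Cmod_pair_triangle; split; apply Cmod_ge_0 || apply Cmod_triangle.
Qed.

Lemma l2_semi_plus m x y :
  l2_semi m (fun i => Cplus (x i) (y i)) <= l2_semi m x + l2_semi m y.
Proof.
  induction m as [| m IH]; simpl; [apply block_plus |].
  apply Cmod_pair_triangle; split;
    apply l2_semi_ge_0 || apply block_ge_0 || assumption || apply block_plus.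
Qed.

Lemma l2_semi_dominated (M : R) x y : 0 <= M ->
  (forall k, block y k <= M * block x k) -> forall m, l2_semi m y <= M * l2_semi m x.
Proof.
  intros hM h m; induction m as [| m IH]; simpl; [apply h |].
  rewrite <- Cmod_pair_scal by exact hM; apply Cmod_pair_mono; split;
    apply l2_semi_ge_0 || apply block_ge_0 || assumption || apply h.
Qed.

Lemma block_scal c x k : block (fun i => Cmult c (x i)) k = Cmod c * block x k.
Proof.
  unfold block; rewrite !Cmod_mult; apply Cmod_pair_scal, Cmod_ge_0.
Qed.

Lemma l2_semi_small m (F : ((pairs -> C) -> Prop) -> Prop) : Filter F ->
  (forall i (d : posreal), F (fun x => Cmod (x i) < d)) ->
  forall e : posreal, F (fun x => l2_semi m x < e).
Proof.
  intros FF h.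
  assert (hb : forall k (e : posreal), F (fun x => block x k < e)).
  { intros k e.
    assert (he : 0 < e / 2) by (assert (h0 := cond_pos e); lra).
    generalize (filter_and _ _ (h (false, k) (mkposreal _ he)) (h (true, k) (mkposreal _ he))).
    apply filter_imp; intros x [h1 h2]; simpl in *.
    eapply Rle_lt_trans; [apply Cmod_pair_le |]; rewrite !Rabs_pos_eq by apply Cmod_ge_0; lra. }
  induction m as [| m IH]; intros e; simpl; [apply hb |].
  assert (he : 0 < e / 2) by (assert (h0 := cond_pos e); lra).
  generalize (filter_and _ _ (IH (mkposreal _ he)) (hb (S m) (mkposreal _ he))).
  apply filter_imp; intros x [h1 h2]; simpl in *.
  eapply Rle_lt_trans; [apply Cmod_pair_le |].
  rewrite !Rabs_pos_eq by (apply l2_semi_ge_0 || apply block_ge_0); lra.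
Qed.

Definition square_summable (x : pairs -> C) : Prop := exists M, forall m, l2_semi m x <= M.

Lemma square_summable_plus x y : square_summable x -> square_summable y ->
  square_summable (fun i => Cplus (x i) (y i)).
Proof.
  intros [M hM] [M' hM']; exists (M + M'); intros m.
  eapply Rle_trans; [apply l2_semi_plus |]; assert (h := hM m); assert (h' := hM' m); lra.
Qed.

Lemma square_summable_dominated (M : R) x y : 0 <= M ->
  (forall k, block y k <= M * block x k) -> square_summable x -> square_summable y.
Proof.
  intros hM h [M' hM']; exists (M * M'); intros m.
  eapply Rle_trans; [apply l2_semi_dominated; eassumption |].
  apply Rmult_le_compat_l; auto.
Qed.

Lemma l2_semi_finite x K : (forall b k, (K < k)%nat -> x (b, k) = RtoC 0) ->
  forall m, l2_semi m x <= l2_semi K x.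
Proof.
  intros h.
  assert (hmono : forall m, l2_semi m x <= l2_semi (S m) x).
  { intros m; apply Cmod_pair_ge_l, l2_semi_ge_0. }
  intros m; destruct (Compare_dec.le_lt_dec m K) as [hm | hm].
  - clear h; induction hm as [| j hj IH]; [apply Rle_refl |].
    eapply Rle_trans; [exact IH | apply hmono].
  - assert (hs : forall j, (K <= j)%nat -> l2_semi j x = l2_semi K x).
    { intros j hj; induction hj as [| j hj IH]; [reflexivity |]; simpl.
      unfold block; rewrite !h by lia; rewrite Cmod_0, !Cmod_pair_0 by (lra || apply l2_semi_ge_0).
      exact IH. }
    rewrite hs by lia; apply Rle_refl.
Qed.

Lemma square_summable_finite x K : (forall b k, (K < k)%nat -> x (b, k) = RtoC 0) ->
  square_summable x.
Proof. intros h; exists (l2_semi K x); now apply l2_semi_finite. Qed.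

Definition l2 : family_space pairs.
Proof.
  apply (Build_family_space pairs square_summable l2_semi).
  - apply (square_summable_finite _ 0); reflexivity.
  - exact square_summable_plus.
  - intros c x; apply (square_summable_dominated (Cmod c)); [apply Cmod_ge_0 |].
    intros k; apply Req_le, block_scal.
  - exact l2_semi_ge_0.
  - exact l2_semi_plus.
  - intros m c x; apply l2_semi_dominated; [apply Cmod_ge_0 |].
    intros k; apply Req_le, block_scal.
  - intros [b k]; exists k; intros x.
    eapply Rle_trans; [apply Cmod_le_block | apply block_le_l2_semi].
  - exact l2_semi_small.
  - easy.
  - intros x h; destruct (h (mkposreal 1 Rlt_0_1)) as [y [[M hM] hy]]; simpl in hy.
    exists (1 + M); intros m.
    replace x with (fun i => Cplus (Cminus (x i) (y i)) (y i))
      by (apply functional_extensionality; intros; ring).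
    eapply Rle_trans; [apply l2_semi_plus |].
    assert (h1 := hy m); assert (h2 := hM m); lra.
Defined.

Definition l2_banach : CompleteNormedModule C_AbsRing := family_CompleteNormedModule l2.

Lemma l2_norm_le (x : l2_banach) M : (forall m, l2_semi m (coord l2 x) <= M) -> norm x <= M.
Proof. exact (norm_le_of_semi l2 x M). Qed.

Lemma l2_semi_le_norm (x : l2_banach) m : l2_semi m (coord l2 x) <= norm x.
Proof. exact (semi_le_norm l2 m x). Qed.

Lemma l2_coord_minus (x y : l2_banach) i :
  coord l2 (minus x y : l2_banach) i = Cminus (coord l2 x i) (coord l2 y i).
Proof. C_ring. Qed.

Lemma l2_semi_sqr m x : l2_semi m x * l2_semi m x = sum_n (fun k => block x k * block x k) m.
Proof.
  induction m as [| m IH]; [now rewrite sum_O |].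
  rewrite sum_n_succ, <- IH; simpl; apply Cmod_pair_sqr.
Qed.

Lemma ex_series_bounded (a : nat -> R) M :
  (forall k, 0 <= a k) -> (forall m, sum_n a m <= M) -> ex_series a.
Proof.
  intros ha hM.
  destruct (ex_finite_lim_seq_incr (sum_n a) M) as [l hl]; [| exact hM | exists l; exact hl].
  intros m; rewrite sum_n_succ; assert (h := ha (S m)); lra.
Qed.

Lemma block_sqr_sum_le (x : l2_banach) m :
  sum_n (fun k => block (coord l2 x) k * block (coord l2 x) k) m <= norm x * norm x.
Proof.
  rewrite <- l2_semi_sqr; apply Rmult_le_compat;
    apply l2_semi_ge_0 || apply l2_semi_le_norm.
Qed.

Lemma ex_series_block_sqr (x : l2_banach) :
  ex_series (fun k => block (coord l2 x) k * block (coord l2 x) k).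
Proof.
  apply ex_series_bounded with (norm x * norm x); [| apply block_sqr_sum_le].
  intros k; apply Rle_0_sqr.
Qed.

Lemma Series_ge_sum_n (a : nat -> R) m :
  (forall k, 0 <= a k) -> ex_series a -> sum_n a m <= Series a.
Proof.
  intros ha ea.
  apply (is_lim_seq_incr_compare (sum_n a)).
  - exact (Series_correct a ea).
  - intros n; rewrite sum_n_succ; assert (h := ha (S n)); lra.
Qed.

(** Links the norm, a supremum of partial Euclidean norms, with the series needed for the inner
    product. *)
Lemma Series_block_sqr (x : l2_banach) :
  Series (fun k => block (coord l2 x) k * block (coord l2 x) k) = norm x * norm x.
Proof.
  set (a := fun k => block (coord l2 x) k * block (coord l2 x) k).
  assert (ha : forall k, 0 <= a k) by (intros k; apply Rle_0_sqr).
  assert (ea : ex_series a) by apply ex_series_block_sqr.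
  apply Rle_antisym.
  - apply (is_lim_seq_le (sum_n a) (fun _ => norm x * norm x)
      (Series a) (norm x * norm x)); [apply block_sqr_sum_le | | apply is_lim_seq_const].
    exact (Series_correct a ea).
  - assert (h0 : 0 <= Series a).
    { eapply Rle_trans; [| apply (Series_ge_sum_n a 0 ha ea)]; rewrite sum_O; apply ha. }
    rewrite <- (sqrt_sqrt (Series a) h0).
    assert (h : norm x <= sqrt (Series a)).
    { apply l2_norm_le; intros m.
      apply Rsqr_incr_0_var; [| apply sqrt_pos].
      rewrite Rsqr_sqrt by exact h0; unfold Rsqr; rewrite l2_semi_sqr.
      now apply Series_ge_sum_n. }
    apply Rmult_le_compat; apply norm_ge_0 || exact h.
Qed.

(** * The inner product and truncations *)

Definition inner_term (x y : pairs -> C) (k : nat) : C :=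
  Cplus (Cmult (x (false, k)) (Cconj (y (false, k))))
        (Cmult (x (true, k)) (Cconj (y (true, k)))).

Definition l2_inner (x y : l2_banach) : C :=
  (Series (fun k => Re (inner_term (coord l2 x) (coord l2 y) k)),
   Series (fun k => Im (inner_term (coord l2 x) (coord l2 y) k))).

(** From 2ab <= a^2 + b^2; the right side is summable, so the series of the inner product converge
    absolutely. *)
Lemma Cmod_inner_term x y k :
  Cmod (inner_term x y k) <= block x k * block x k + block y k * block y k.
Proof.
  unfold inner_term; eapply Rle_trans; [apply Cmod_triangle |].
  rewrite !Cmod_mult, !Cmod_conj; unfold block; rewrite !Cmod_pair_sqr.
  set (a := Cmod (x (false, k))); set (b := Cmod (x (true, k))).
  set (c := Cmod (y (false, k))); set (d := Cmod (y (true, k))).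
  assert (h1 := Rle_0_sqr (a - c)); assert (h2 := Rle_0_sqr (b - d)).
  assert (h3 := Rle_0_sqr a); assert (h4 := Rle_0_sqr b).
  assert (h5 := Rle_0_sqr c); assert (h6 := Rle_0_sqr d).
  unfold Rsqr in *; nra.
Qed.

Lemma ex_series_inner (x y : l2_banach) :
  ex_series (fun k => Re (inner_term (coord l2 x) (coord l2 y) k)) /\
  ex_series (fun k => Im (inner_term (coord l2 x) (coord l2 y) k)).
Proof.
  assert (h := ex_series_plus _ _ (ex_series_block_sqr x) (ex_series_block_sqr y)).
  split; refine (ex_series_le (V := R_CompleteNormedModule) _ _ _ h); intros k;
    (eapply Rle_trans; [| apply Cmod_inner_term]).
  - apply re_le_Cmod.
  - eapply Rle_trans; [| apply Rmax_Cmod]; apply Rmax_r.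
Qed.

Definition l2_hilbert : HilbertSpace.
Proof.
  apply (Build_HilbertSpace l2_banach l2_inner).
  - intros x y z.
    destruct (ex_series_inner x z) as [h1 h2]; destruct (ex_series_inner y z) as [h3 h4].
    apply injective_projections; simpl; rewrite <- Series_plus by assumption;
      apply Series_ext; intros k; unfold inner_term, coord, Re, Im; simpl; ring.
  - intros c x y; destruct (ex_series_inner x y) as [h1 h2].
    apply injective_projections; simpl; rewrite <- !Series_scal_l.
    + rewrite <- Series_minus by now apply (ex_series_scal_l (V := R_NormedModule)).
      apply Series_ext; intros k; unfold inner_term, coord, Re, Im; simpl; ring.
    + rewrite <- Series_plus by now apply (ex_series_scal_l (V := R_NormedModule)).
      apply Series_ext; intros k; unfold inner_term, coord, Re, Im; simpl; ring.
  - intros x y; apply injective_projections; simpl; [| rewrite <- Series_opp];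
      apply Series_ext; intros k; unfold inner_term, Re, Im; simpl; ring.
  - intros x; apply injective_projections; simpl.
    + rewrite <- Series_block_sqr; apply Series_ext; intros k.
      unfold block, inner_term; rewrite Cmod_pair_sqr.
      assert (h : forall z, Cmod z * Cmod z = Re z * Re z + Im z * Im z).
      { intros z; assert (h := Cmod2_alt z); nra. }
      rewrite !h; unfold Re, Im; simpl; ring.
    + transitivity (Series (fun _ => 0 * 0)).
      * apply Series_ext; intros k; unfold inner_term, Im; simpl; ring.
      * rewrite Series_scal_l; ring.
Defined.

Lemma Series_single (a : nat -> R) k : (forall j, j <> k -> a j = 0) -> Series a = a k.
Proof.
  intros h; apply is_series_unique.
  assert (h1 : forall m, (m < k)%nat -> sum_n a m = 0).
  { induction m as [| m IH]; intros hm; [rewrite sum_O; apply h; lia |].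
    rewrite sum_n_succ, IH, h by lia; apply Rplus_0_l. }
  assert (h2 : forall m, (k <= m)%nat -> sum_n a m = a k).
  { intros m hm; induction hm as [| m hm IH].
    - destruct k as [| k]; [apply sum_O |].
      rewrite sum_n_succ, h1 by lia; apply Rplus_0_l.
    - rewrite sum_n_succ, IH, (h (S m)) by lia; apply Rplus_0_r. }
  apply (filterlim_ext_loc (fun _ => a k)); [| apply filterlim_const].
  exists k; intros m hm; symmetry; now apply h2.
Qed.

Lemma l2_inner_single (x y : l2_hilbert) k :
  (forall j, j <> k -> inner_term (coord l2 x) (coord l2 y) j = RtoC 0) ->
  inner x y = inner_term (coord l2 x) (coord l2 y) k.
Proof.
  intros h; simpl; unfold l2_inner.
  rewrite !(Series_single _ k) by (intros j hj; rewrite h by exact hj; reflexivity).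
  destruct (inner_term (coord l2 x) (coord l2 y) k); reflexivity.
Qed.

Lemma l2_inner_ext (x y x' y' : l2_hilbert) :
  (forall k, inner_term (coord l2 x) (coord l2 y) k = inner_term (coord l2 x') (coord l2 y') k) ->
  inner x y = inner x' y'.
Proof.
  intros h; simpl; unfold l2_inner; f_equal; apply Series_ext; intros k; now rewrite h.
Qed.

Definition truncate (m : nat) (x : pairs -> C) (i : pairs) : C :=
  if Compare_dec.le_lt_dec (snd i) m then x i else RtoC 0.

Lemma truncate_finite m x b k : (m < k)%nat -> truncate m x (b, k) = RtoC 0.
Proof. unfold truncate; simpl; intros h; destruct Compare_dec.le_lt_dec; [lia | reflexivity]. Qed.

(** Pythagoras: the error of the truncation is supported on the blocks beyond [m], so its square is
    a difference of partial sums. *)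
Lemma l2_semi_truncate m x : forall j, l2_semi j (fun i => Cminus (truncate m x i) (x i)) *
    l2_semi j (fun i => Cminus (truncate m x i) (x i)) =
  if Compare_dec.le_lt_dec j m then 0 else l2_semi j x * l2_semi j x - l2_semi m x * l2_semi m x.
Proof.
  set (z := fun i => Cminus (truncate m x i) (x i)).
  assert (h1 : forall k, (k <= m)%nat -> block z k = 0).
  { intros k hk; unfold block, z, truncate; simpl; destruct Compare_dec.le_lt_dec; [| lia].
    unfold Cminus; rewrite !Cplus_opp_r, Cmod_0; apply Cmod_0. }
  assert (h2 : forall k, (m < k)%nat -> block z k = block x k).
  { intros k hk; unfold block, z; rewrite !truncate_finite by exact hk.
    unfold Cminus; rewrite !Cplus_0_l, !Cmod_opp; reflexivity. }
  induction j as [| j IH]; simpl l2_semi.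
  - destruct Compare_dec.le_lt_dec; [rewrite h1 by lia; ring | lia].
  - rewrite !Cmod_pair_sqr, IH.
    destruct (Compare_dec.le_lt_dec j m); destruct (Compare_dec.le_lt_dec (S j) m); try lia.
    + rewrite h1 by lia; ring.
    + replace j with m by lia; rewrite h2 by lia; ring.
    + rewrite h2 by lia; ring.
Qed.

Lemma finite_dense (x : l2_banach) (e : R) : 0 < e ->
  exists m, norm (minus (make l2 (truncate m (coord l2 x)) : l2_banach) x) < e.
Proof.
  intros he.
  (* Otherwise all partial sums, hence their limit [norm x * norm x], would stay below the norm
     squared by a fixed amount. *)
  assert (hs : exists m, norm x * norm x - e / 2 * (e / 2) <
     l2_semi m (coord l2 x) * l2_semi m (coord l2 x)).
  { apply not_all_not_ex; intros h.
    assert (hS : Series (fun k => block (coord l2 x) k * block (coord l2 x) k)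
      <= norm x * norm x - e / 2 * (e / 2)).
    { apply (is_lim_seq_le (sum_n (fun k => block (coord l2 x) k * block (coord l2 x) k))
        (fun _ => norm x * norm x - e / 2 * (e / 2))
        (Series (fun k => block (coord l2 x) k * block (coord l2 x) k))
        (norm x * norm x - e / 2 * (e / 2))).
      - intros m; rewrite <- l2_semi_sqr; apply Rnot_lt_le, h.
      - exact (Series_correct _ (ex_series_block_sqr x)).
      - apply is_lim_seq_const. }
    rewrite Series_block_sqr in hS; nra. }
  destruct hs as [m hm]; exists m.
  apply Rle_lt_trans with (e / 2); [| lra].
  apply l2_norm_le; intros j.
  apply Rsqr_incr_0_var; [unfold Rsqr | lra].
  replace (coord l2 (minus (make l2 (truncate m (coord l2 x)) : l2_banach) x)) with
    (fun i => Cminus (truncate m (coord l2 x) i) (coord l2 x i)).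
  - rewrite l2_semi_truncate; destruct Compare_dec.le_lt_dec; [nra |].
    assert (h1 := l2_semi_le_norm x j); assert (h2 := l2_semi_ge_0 j (coord l2 x)); nra.
  - apply functional_extensionality; intros i; rewrite l2_coord_minus, coord_make; [reflexivity |].
    apply (square_summable_finite _ m); intros; now apply truncate_finite.
Qed.

(** * The counterexample in l^2 *)

Lemma square_summable_ext x y : (forall i, x i = y i) -> square_summable x -> square_summable y.
Proof. intros h; now rewrite (functional_extensionality x y h). Qed.

(** The blocks of the skew-hermitian matrix [[0, - conj c_k], [c_k, 0]]. *)
Definition skew_blocks (c : nat -> C) (x : pairs -> C) (i : pairs) : C :=
  match i with
  | (false, k) => Copp (Cmult (Cconj (c k)) (x (true, k)))
  | (true, k) => Cmult (c k) (x (false, k))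
  end.

(** The block swaps the two components and multiplies both by numbers of modulus |c_k|, so it is
    |c_k| times an isometry. *)
Lemma block_skew_blocks c x k : block (skew_blocks c x) k = Cmod (c k) * block x k.
Proof.
  unfold block; simpl; rewrite Cmod_opp, !Cmod_mult, Cmod_conj, Cmod_pair_scal by apply Cmod_ge_0.
  f_equal; unfold Cmod; simpl; f_equal; ring.
Qed.

(** With u = w d one has min(2, u) <= 2 u^alpha: for u <= 1 because u <= u^alpha, for u > 1 because
    u^alpha >= 1. The factor w^-alpha then cancels w^alpha. *)
Lemma Rpower_holder (alpha w d : R) : 0 < alpha < 1 -> 0 < w -> 0 < d ->
  Rpower w (- alpha) * Rmin 2 (w * d) <= 2 * Rpower d alpha.
Proof.
  intros ha hw hd.
  assert (h1 : Rmin 2 (w * d) <= 2 * Rpower (w * d) alpha).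
  { destruct (Rle_lt_dec (w * d) 1) as [h | h].
    - eapply Rle_trans; [apply Rmin_r |].
      assert (hwd : 0 < w * d) by now apply Rmult_lt_0_compat.
      assert (hle : w * d <= Rpower (w * d) alpha).
      { rewrite <- (Rpower_1 (w * d) hwd) at 1; unfold Rpower.
        assert (hln : ln (w * d) <= 0).
        { rewrite <- ln_1; destruct h as [h | ->]; [apply Rlt_le, ln_increasing; lra | lra]. }
        destruct (Req_dec (1 * ln (w * d)) (alpha * ln (w * d))) as [-> | hne]; [lra |].
        apply Rlt_le, exp_increasing; nra. }
      assert (h0 := exp_pos (alpha * ln (w * d))); unfold Rpower in *; lra.
    - eapply Rle_trans; [apply Rmin_l |].
      assert (h2 : 1 <= Rpower (w * d) alpha).
      { unfold Rpower; rewrite <- exp_0; apply Rlt_le, exp_increasing.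
        apply Rmult_lt_0_compat; [lra |]; rewrite <- ln_1; apply ln_increasing; lra. }
      lra. }
  apply (Rmult_le_compat_l (Rpower w (- alpha))) in h1; [| apply Rlt_le, exp_pos].
  eapply Rle_trans; [exact h1 |].
  rewrite <- Rpower_mult_distr by assumption.
  replace (Rpower w (- alpha) * (2 * (Rpower w alpha * Rpower d alpha))) with
    (2 * ((Rpower w (- alpha) * Rpower w alpha) * Rpower d alpha)) by ring.
  rewrite <- Rpower_plus, Rplus_opp_l, Rpower_O by exact hw; lra.
Qed.

Section OscillatingBlocks.

Variables w eps : nat -> R.
Hypothesis w_ge_0 : forall k, 0 <= w k.
Hypothesis eps_bounds : forall k, 0 <= eps k <= 1.

Definition coupling (t : R) (k : nat) : C := Cmult (RtoC (eps k)) (cis (w k * t)).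

Definition frequency (i : pairs) : R := if fst i then w (snd i) else 0.

Definition blocks_l2 (t : R) (x : pairs -> C) (i : pairs) : C :=
  Cplus (skew_blocks (coupling t) x i) (Cmult (0, frequency i) (x i)).

Definition A_l2 (t : R) (x : l2_hilbert) : l2_hilbert := make l2 (blocks_l2 t (coord l2 x)).

Definition D_l2 (x : l2_hilbert) : Prop :=
  member l2 (fun i => Cmult (0, frequency i) (coord l2 x i)).

Lemma Cmod_coupling t k : Cmod (coupling t k) = eps k.
Proof.
  unfold coupling; rewrite Cmod_mult, Cmod_cis, Cmod_R, Rabs_pos_eq by apply eps_bounds; ring.
Qed.

Lemma skew_coupling_member t x : square_summable x -> square_summable (skew_blocks (coupling t) x).
Proof.
  apply (square_summable_dominated 1); [lra |].
  intros k; rewrite block_skew_blocks, Cmod_coupling.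
  apply Rmult_le_compat_r; [apply block_ge_0 | apply eps_bounds].
Qed.

Lemma D_l2_iff t (x : l2_hilbert) : D_l2 x <-> member l2 (blocks_l2 t (coord l2 x)).
Proof.
  assert (hB : square_summable (skew_blocks (coupling t) (coord l2 x)))
    by apply skew_coupling_member, (proj2_sig x).
  unfold D_l2; simpl; split; intros h.
  - now apply square_summable_plus.
  - refine (square_summable_ext _ _ _
      (square_summable_plus _ _ h (member_scal _ l2 (RtoC (-1)) _ hB))).
    intros i; unfold blocks_l2; C_ring.
Qed.

Lemma A_l2_coord t (x : l2_hilbert) i : D_l2 x -> coord l2 (A_l2 t x) i = blocks_l2 t (coord l2 x) i.
Proof. intros h; unfold A_l2; rewrite coord_make; [reflexivity | now apply D_l2_iff]. Qed.

Lemma D_l2_subspace : subspace D_l2.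
Proof.
  unfold D_l2; simpl; repeat split.
  - apply (square_summable_finite _ 0); intros b k _; apply Cmult_0_r.
  - intros x y hx hy.
    refine (square_summable_ext _ _ _ (square_summable_plus _ _ hx hy)); intros i; C_ring.
  - intros c x hx.
    refine (square_summable_ext _ _ _ (member_scal _ l2 c _ hx)); intros i; C_ring.
Qed.

Lemma D_l2_finite (x : pairs -> C) m :
  (forall b k, (m < k)%nat -> x (b, k) = RtoC 0) -> D_l2 (make l2 x).
Proof.
  intros h; unfold D_l2; rewrite coord_make by now apply (square_summable_finite x m).
  apply (square_summable_finite _ m); intros b k hk; rewrite h by exact hk; apply Cmult_0_r.
Qed.

Lemma D_l2_dense : dense D_l2.
Proof.
  intros x e he; destruct (finite_dense x e he) as [m hm].
  exists (make l2 (truncate m (coord l2 x))); split; [| exact hm].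
  apply (D_l2_finite _ m); intros; now apply truncate_finite.
Qed.

Lemma A_l2_linear t : linear_on D_l2 (A_l2 t).
Proof.
  destruct D_l2_subspace as [_ [hp hs]]; split.
  - intros x y hx hy; apply coord_inj; intros i.
    transitivity (Cplus (coord l2 (A_l2 t x) i) (coord l2 (A_l2 t y) i)); [| C_ring].
    rewrite !A_l2_coord by auto; unfold blocks_l2; destruct i as [[|] k]; C_ring.
  - intros c x hx; apply coord_inj; intros i.
    transitivity (Cmult c (coord l2 (A_l2 t x) i)); [| C_ring].
    rewrite !A_l2_coord by auto; unfold blocks_l2; destruct i as [[|] k]; C_ring.
Qed.

Lemma A_l2_close (K t s : R) (y : l2_hilbert) : 0 <= K ->
  (forall k, eps k * Cmod (Cminus (cis (w k * t)) (cis (w k * s))) <= K) -> D_l2 y ->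
  norm (minus (A_l2 t y) (A_l2 s y)) <= K * norm y.
Proof.
  intros hK h hy; apply l2_norm_le; intros m.
  set (c := fun k => Cminus (coupling t k) (coupling s k)).
  replace (coord l2 (minus (A_l2 t y) (A_l2 s y))) with (skew_blocks c (coord l2 y)).
  - eapply Rle_trans; [apply (l2_semi_dominated K (coord l2 y)) |].
    + exact hK.
    + intros k; rewrite block_skew_blocks.
      apply Rmult_le_compat_r; [apply block_ge_0 |].
      eapply Rle_trans; [| apply (h k)]; apply Req_le.
      rewrite <- (Rabs_pos_eq (eps k)) at 1 by apply eps_bounds.
      rewrite <- Cmod_R, <- Cmod_mult; f_equal; unfold c, coupling; ring.
    + apply Rmult_le_compat_l; [exact hK | apply l2_semi_le_norm].
  - apply functional_extensionality; intros i.
    transitivity (Cminus (coord l2 (A_l2 t y) i) (coord l2 (A_l2 s y) i)); [| C_ring].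
    rewrite !A_l2_coord by exact hy; unfold blocks_l2, c; destruct i as [[|] k]; C_ring.
Qed.

(** Each block is skew-hermitian, an identity in two coordinates that involves no convergence. *)
Lemma inner_term_blocks t x y k :
  inner_term (blocks_l2 t y) x k = inner_term y (fun i => Copp (blocks_l2 t x i)) k.
Proof. unfold inner_term, blocks_l2, frequency; C_ring. Qed.

Definition unit_vector (b : bool) (k : nat) (i : pairs) : C :=
  if Bool.eqb (fst i) b then if PeanoNat.Nat.eq_dec (snd i) k then RtoC 1 else RtoC 0
  else RtoC 0.

Lemma unit_vector_off b k b' j : j <> k -> unit_vector b k (b', j) = RtoC 0.
Proof.
  intros h; unfold unit_vector; simpl.
  destruct Bool.eqb; [destruct PeanoNat.Nat.eq_dec; easy | reflexivity].
Qed.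

(** Testing the adjoint relation on unit vectors, which lie in the domain, gives [z] coordinatewise
    as minus the formal image of [x]. As [z] is square-summable, so is that image, and this places
    [x] in the domain. *)
Lemma A_l2_skew_selfadjoint t : skew_selfadjoint D_l2 (A_l2 t).
Proof.
  split; [apply A_l2_linear |].
  intros x z; split.
  - intros h.
    assert (hz : forall b k, coord l2 z (b, k) = Copp (blocks_l2 t (coord l2 x) (b, k))).
    { intros b k.
      set (e := make l2 (unit_vector b k) : l2_hilbert).
      assert (hfin : forall b' j, (k < j)%nat -> unit_vector b k (b', j) = RtoC 0)
        by (intros; apply unit_vector_off; lia).
      assert (he : coord l2 e = unit_vector b k)
        by (apply coord_make; now apply (square_summable_finite _ k)).
      assert (heD : D_l2 e) by now apply (D_l2_finite _ k).
      assert (heA : coord l2 (A_l2 t e) = blocks_l2 t (unit_vector b k)).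
      { apply functional_extensionality; intros i; rewrite A_l2_coord by exact heD.
        now rewrite he. }
      assert (h1 := h e heD).
      rewrite (l2_inner_single _ _ k) in h1.
      2: { intros j hj; rewrite heA, inner_term_blocks; unfold inner_term.
        rewrite !unit_vector_off by exact hj; ring. }
      rewrite (l2_inner_single _ _ k) in h1.
      2: { intros j hj; rewrite he; unfold inner_term.
        rewrite !unit_vector_off by exact hj; ring. }
      rewrite heA, inner_term_blocks, he in h1; unfold inner_term, unit_vector in h1; simpl in h1.
      destruct (PeanoNat.Nat.eq_dec k k) as [_ | ]; [| easy].
      set (p := blocks_l2 t (coord l2 x)) in *.
      (* The tested vector sits in the second, conjugated slot, so [h1] compares conjugates. *)
      rewrite <- (Cconj_conj (coord l2 z (b, k))), <- (Cconj_conj (Copp (p (b, k)))); f_equal.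
      destruct b; simpl in h1.
      - transitivity (Cplus (Cmult (RtoC 0) (Cconj (coord l2 z (false, k))))
          (Cmult (RtoC 1) (Cconj (coord l2 z (true, k))))); [ring |].
        rewrite <- h1; ring.
      - transitivity (Cplus (Cmult (RtoC 1) (Cconj (coord l2 z (false, k))))
          (Cmult (RtoC 0) (Cconj (coord l2 z (true, k))))); [ring |].
        rewrite <- h1; ring. }
    assert (hx : D_l2 x).
    { apply (D_l2_iff t).
      refine (square_summable_ext _ _ _ (member_scal _ l2 (RtoC (-1)) _ (proj2_sig z))).
      intros [b k]; change (proj1_sig z) with (coord l2 z); rewrite hz; C_ring. }
    split; [exact hx |].
    apply coord_inj; intros [b k]; rewrite hz, <- A_l2_coord by exact hx; C_ring.
  - intros [hx ->] y hy; apply l2_inner_ext; intros k.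
    replace (coord l2 (A_l2 t y)) with (blocks_l2 t (coord l2 y))
      by (apply functional_extensionality; intros i; now rewrite A_l2_coord).
    rewrite inner_term_blocks; f_equal.
    apply functional_extensionality; intros i.
    rewrite <- A_l2_coord by exact hx; C_ring.
Qed.

Lemma A_l2_holder alpha : 0 < alpha < 1 -> (forall k, 0 < w k) ->
  (forall k, eps k = Rpower (w k) (- alpha)) -> holder_LYX 1 alpha D_l2 A_l2.
Proof.
  intros ha hw heps.
  (* [Rpower_holder] needs a positive distance; on the diagonal the trivial bound [eps k * 2 <= 2]
     serves instead. *)
  set (K := fun t s => if Req_EM_T t s then 2 else 2 * Rpower (Rabs (t - s)) alpha).
  assert (hK : forall t s, 0 <= K t s).
  { intros t s; unfold K; destruct Req_EM_T; [lra |].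
    unfold Rpower; assert (h := exp_pos (alpha * ln (Rabs (t - s)))); lra. }
  assert (hc : forall t s, in_I 1 t -> in_I 1 s -> forall y, D_l2 y ->
    norm (minus (A_l2 t y) (A_l2 s y)) <= K t s * norm y).
  { intros t s _ _ y hy; apply A_l2_close; [apply hK | | exact hy].
    intros k; unfold K; destruct Req_EM_T as [e | hne].
    - apply Rle_trans with (1 * 2); [| lra].
      apply Rmult_le_compat; [apply eps_bounds | apply Cmod_ge_0 | apply eps_bounds |].
      apply Cmod_cis_sub_2.
    - rewrite heps.
      eapply Rle_trans; [apply Rmult_le_compat_l; [apply Rlt_le, exp_pos |] |
        apply (Rpower_holder alpha (w k)); [exact ha | apply hw | apply Rabs_pos_lt; lra]].
      apply Rmin_glb; [apply Cmod_cis_sub_2 |].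
      eapply Rle_trans; [apply Cmod_cis_sub |].
      rewrite <- Rmult_minus_distr_l, Rabs_mult, (Rabs_pos_eq (w k)) by apply w_ge_0; lra. }
  split.
  - apply (perturbation_in_LYX D_l2 1 A_l2 K hK hc); [lra |]; intros t _; apply A_l2_linear.
  - exists 2; intros s t hs ht hne.
    eapply Rle_trans; [apply (dist_YX_le D_l2 1 A_l2 K hK hc t s ht hs) |].
    unfold K; destruct Req_EM_T; [congruence | lra].
Qed.

(** * The trajectory in l^2 that leaves the domain *)

Definition harmonic_vector (i : pairs) : C :=
  if fst i then RtoC 0 else RtoC (/ INR (S (snd i))).

Lemma harmonic_vector_member : square_summable harmonic_vector.
Proof.
  assert (hp : forall m, 0 < INR (S m)) by (intros m; apply lt_0_INR; lia).
  assert (hb : forall k, block harmonic_vector k * block harmonic_vector k =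
    / INR (S k) * / INR (S k)).
  { intros k; unfold block, harmonic_vector; simpl fst; simpl snd; cbv iota.
    rewrite Cmod_pair_sqr, Cmod_0, Cmod_R, Rabs_pos_eq; [ring |].
    apply Rlt_le, Rinv_0_lt_compat, hp. }
  exists 2; intros m.
  apply Rsqr_incr_0_var; [| lra]; unfold Rsqr; rewrite l2_semi_sqr.
  (* Telescoping: 1/(k+1)^2 <= 1/k - 1/(k+1) for k >= 1. *)
  apply Rle_trans with (2 - / INR (S m)).
  - induction m as [| m IH].
    + rewrite sum_O, hb; simpl; lra.
    + rewrite sum_n_succ, hb.
      assert (h1 : / INR (S (S m)) * / INR (S (S m)) <= / INR (S m) - / INR (S (S m))).
      { rewrite (S_INR (S m)); assert (h := hp m); set (a := INR (S m)) in *.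
        replace (/ a - / (a + 1)) with (/ (a + 1) * / a) by (field; lra).
        apply Rmult_le_compat_l; [apply Rlt_le, Rinv_0_lt_compat; lra |].
        apply Rinv_le_contravar; lra. }
      lra.
  - assert (h := Rinv_0_lt_compat _ (hp m)); lra.
Qed.

(** The Taylor minorant a - a^3/6 is at least a/2 on [0,1]. *)
Lemma sin_ge_half a : 0 <= a <= 1 -> a / 2 <= sin a.
Proof.
  intros ha; destruct (sin_bound a 0) as [h _]; [lra | assert (h := PI2_1); lra |].
  unfold sin_approx, sin_term in h; simpl in h.
  eapply Rle_trans; [| exact h]; nra.
Qed.

Lemma rotation_of_is_derive (e : R) (f g : R -> R) :
  (forall t, continuity_pt f t) -> (forall t, continuity_pt g t) ->
  (forall t, 0 < t < 1 -> is_derive f t (e * g t)) ->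
  (forall t, 0 < t < 1 -> is_derive g t (- e * f t)) ->
  f 0 = 0 -> f 1 = sin e * g 0.
Proof.
  intros cf cg df dg hf0.
  (* The pair (f, g) turns with angular speed [e]; [P] and [Q] are its coordinates in the frame
     turning along, hence constant. *)
  set (P := fun t => cos (e * t) * f t - sin (e * t) * g t).
  set (Q := fun t => sin (e * t) * f t + cos (e * t) * g t).
  assert (cP : forall t, continuity_pt P t).
  { intros t; apply (continuity_pt_minus (fun t => _ * _) (fun t => _ * _));
      apply (continuity_pt_mult (fun t => _) (fun t => _)); auto; reg. }
  assert (cQ : forall t, continuity_pt Q t).
  { intros t; apply (continuity_pt_plus (fun t => _ * _) (fun t => _ * _));
      apply (continuity_pt_mult (fun t => _) (fun t => _)); auto; reg. }
  assert (hP : P 1 = P 0).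
  { apply eq_of_is_derive_0; [lra | exact cP |]; intros t ht.
    assert (h1 := df t ht); assert (h2 := dg t ht); unfold P.
    auto_derive; [repeat split; eexists; eassumption |].
    replace (Derive (fun x => f x) t) with (Derive f t) by reflexivity.
    replace (Derive (fun x => g x) t) with (Derive g t) by reflexivity.
    rewrite (is_derive_unique _ _ _ h1), (is_derive_unique _ _ _ h2); ring. }
  assert (hQ : Q 1 = Q 0).
  { apply eq_of_is_derive_0; [lra | exact cQ |]; intros t ht.
    assert (h1 := df t ht); assert (h2 := dg t ht); unfold Q.
    auto_derive; [repeat split; eexists; eassumption |].
    replace (Derive (fun x => f x) t) with (Derive f t) by reflexivity.
    replace (Derive (fun x => g x) t) with (Derive g t) by reflexivity.
    rewrite (is_derive_unique _ _ _ h1), (is_derive_unique _ _ _ h2); ring. }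
  unfold P, Q in hP, hQ; rewrite Rmult_0_r, cos_0, sin_0, hf0, Rmult_1_r in hP, hQ.
  assert (h := sin2_cos2 e); unfold Rsqr in h.
  transitivity ((sin e * sin e + cos e * cos e) * f 1); [rewrite h; ring |].
  transitivity (cos e * (cos e * f 1 - sin e * g 1) + sin e * (sin e * f 1 + cos e * g 1)); [ring |].
  rewrite hP, hQ; ring.
Qed.

Lemma A_l2_no_evolution_system U : (forall k, w k * eps k = INR (S k)) ->
  ~ evolution_system 1 D_l2 A_l2 U.
Proof.
  intros hweps hU.
  set (y := make l2 harmonic_vector : l2_hilbert).
  assert (hy : coord l2 y = harmonic_vector) by (apply coord_make, harmonic_vector_member).
  assert (hyD : D_l2 y).
  { unfold D_l2; rewrite hy; apply (square_summable_finite _ 0).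
    intros [|] k _; unfold frequency, harmonic_vector; C_ring. }
  assert (h0 : in_I 1 0) by (unfold in_I; lra).
  assert (h1 : in_I 1 1) by (unfold in_I; lra).
  set (x := fun r => U r 0 y).
  assert (hxD : forall t, in_I 1 t -> D_l2 (x t)) by (intros t ht; now apply (es_domain _ _ _ _ _ hU)).
  assert (hx : forall t, in_I 1 t -> is_derive_on 1 x t (A_l2 t (x t))).
  { intros t ht; now apply (es_derive _ _ _ _ _ hU). }
  assert (hxc : forall k t, in_I 1 t -> coord l2 (A_l2 t (x t)) (true, k) =
    Cplus (Cmult (RtoC (eps k)) (Cmult (cis (w k * t)) (coord l2 (x t) (false, k))))
          (Cmult (0, w k) (coord l2 (x t) (true, k)))).
  { intros k t ht; rewrite A_l2_coord by auto; unfold blocks_l2, frequency, coupling; simpl; ring. }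
  assert (hx0 : x 0 = y) by now apply (es_id _ _ _ _ _ hU).
  (* The modulus is at least w_k sin(e_k) / (k + 1), and sin(e_k) >= e_k / 2 with w_k e_k = k +
     1. *)
  assert (hgrow : forall k, / 2 <= Cmod (Cmult (0, w k) (coord l2 (x 1) (true, k)))).
  { intros k.
    set (f := rotating l2 1 (w k) (true, k) x).
    set (g := fun t : R => Re (coord l2 (x (clamp 1 t)) (false, k))).
    assert (hf : f 1 = sin (eps k) * g 0).
    { apply rotation_of_is_derive.
      - intros t; apply (rotating_continuity l2 1 _ _ x (fun t => A_l2 t (x t))); [lra | exact hx].
      - apply (functional_continuity _ 1 x (Re_functional l2 (false, k))); [lra |]; eauto.
      - intros t ht; unfold f.
        exact (rotating_is_derive l2 1 (w k) (eps k) (true, k) (false, k) x _ hx (hxc k) t ht).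
      - intros t ht; assert (hI : in_I 1 t) by (unfold in_I; lra).
        assert (h := functional_is_derive _ 1 x (Re_functional l2 (false, k)) t _ ht (hx t hI)).
        cbv beta in h; rewrite A_l2_coord in h by auto.
        (* The conjugated coupling carries the phase e^(-iwt) of the rotating frame, so the slow
           component is driven by [f] itself. *)
        replace (Re _) with (- eps k * f t) in h; [exact h |].
        unfold f, rotating; rewrite clamp_id by exact hI.
        unfold blocks_l2, frequency, coupling, cis, Re, Im; simpl; ring.
      - unfold f; rewrite rotating_0 by lra; rewrite hx0, hy; reflexivity. }
    assert (hg : g 0 = / INR (S k)) by (unfold g; rewrite clamp_id, hx0, hy by exact h0; reflexivity).
    assert (hle := rotating_le_Cmod l2 1 (w k) (true, k) x 1 h1); fold f in hle.
    rewrite hf, hg in hle; rewrite Cmod_mult, Cmod_imag by apply w_ge_0.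
    assert (hs := sin_ge_half _ (eps_bounds k)).
    assert (hp : 0 < INR (S k)) by (apply lt_0_INR; lia).
    assert (hi := Rinv_0_lt_compat _ hp).
    apply Rle_trans with (w k * (eps k / 2 * / INR (S k))).
    - replace (w k * (eps k / 2 * / INR (S k))) with (w k * eps k / 2 * / INR (S k)) by (unfold Rdiv; ring).
      rewrite hweps; apply Req_le; field; lra.
    - apply Rmult_le_compat_l; [apply w_ge_0 |].
      eapply Rle_trans; [| exact hle]; apply Rmult_le_compat_r; lra. }
  destruct (hxD 1 h1) as [M hM].
  set (z := fun i => Cmult (0, frequency i) (coord l2 (x 1) i)) in hM.
  (* Every block contributes at least (1/2)^2, so the partial sums pass the bound [M * M] of
     square-summability. *)
  assert (hsum : forall m, INR (S m) / 4 <= l2_semi m z * l2_semi m z).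
  { assert (hb : forall k, / 4 <= block z k * block z k).
    { intros k; assert (h := hgrow k); assert (h' := Cmod_le_block z true k).
      unfold z at 1, frequency in h'; simpl in h'.
      assert (h2 : / 2 <= block z k) by lra; nra. }
    intros m; rewrite l2_semi_sqr; induction m as [| m IH].
    - rewrite sum_O; assert (h := hb 0%nat); simpl; lra.
    - rewrite sum_n_succ, S_INR; assert (h := hb (S m)); lra. }
  destruct (INR_unbounded (4 * (M * M))) as [m hm].
  assert (h2 := hsum m); assert (h3 := hM m); assert (h4 := l2_semi_ge_0 m z).
  rewrite S_INR in h2; nra.
Qed.

End OscillatingBlocks.

Theorem mainTheorem2 :
  (~ forall (T : R) (X : CompleteNormedModule C_AbsRing) (D : X -> Prop)
       (omega : R) (A : R -> X -> X),
     0 < T ->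
     subspace D ->
     (forall t, in_I T t -> generates_group_bounded_by D (A t) omega) ->
     continuous_LYX T D A ->
     bounded_variation_LYX T D A ->
     exists_unique_evolution_system T D A)
  /\
  (forall alpha : R, 0 < alpha < 1 ->
   ~ forall (T : R) (X : HilbertSpace) (D : X -> Prop) (A : R -> X -> X),
     0 < T ->
     subspace D ->
     dense D ->
     (forall t, in_I T t -> skew_selfadjoint D (A t)) ->
     holder_LYX T alpha D A ->
     exists_unique_evolution_system T D A).
Proof.
  split.
  - intros h.
    destruct (h 1 c0_banach D_c0 1 A_c0) as [U [hU _]].
    + lra.
    + exact D_c0_subspace.
    + intros t _; apply A_c0_generates.
    + exact A_c0_continuous.
    + exact A_c0_bounded_variation.
    + exact (A_c0_no_evolution_system U hU).
  - intros alpha ha h.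
    set (w := fun k => Rpower (INR (S k)) (/ (1 - alpha))).
    set (eps := fun k => Rpower (w k) (- alpha)).
    assert (hn : forall k, 1 <= INR (S k)) by (intros k; apply (le_INR 1); lia).
    assert (hi : 0 < / (1 - alpha)) by (apply Rinv_0_lt_compat; lra).
    (* Frequencies of at least 1 give [eps k <= 1], which bounds the coupling and keeps the angle in
       the range of [sin_ge_half]. *)
    assert (hw : forall k, 1 <= w k).
    { intros k; assert (h0 := hn k).
      rewrite <- (Rpower_O (INR (S k))) at 1 by lra; apply Rle_Rpower; lra. }
    assert (heps : forall k, 0 <= eps k <= 1).
    { intros k; unfold eps; split; [apply Rlt_le, exp_pos |].
      assert (h0 := hw k); rewrite <- (Rpower_O (w k)) by lra; apply Rle_Rpower; lra. }
    assert (hw0 : forall k, 0 < w k) by (intros k; assert (h0 := hw k); lra).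
    assert (hw0' : forall k, 0 <= w k) by (intros k; apply Rlt_le, hw0).
    destruct (h 1 l2_hilbert (D_l2 w) (A_l2 w eps)) as [U [hU _]].
    + lra.
    + apply D_l2_subspace.
    + apply D_l2_dense.
    + intros t _; now apply A_l2_skew_selfadjoint.
    + now apply A_l2_holder.
    + revert hU; apply A_l2_no_evolution_system; try assumption.
      intros k; unfold eps; rewrite <- (Rpower_1 (w k)) at 1 by apply hw0.
      rewrite <- Rpower_plus; unfold w; rewrite Rpower_mult.
      replace (/ (1 - alpha) * (1 + - alpha)) with 1 by (field; lra).
      apply Rpower_1; assert (h0 := hn k); lra.
Qed.
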